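(* Let $\Gamma$ be a word hyperbolic group and let $\mu$ be a non-elementary probability measure with finite first moment on $\Gamma$. If $0\le\rho,\rho'\le 1$ satisfy $h(\pi^\rho)\neq h(\pi^{\rho'})$, then $$\|\pi^\rho_n-\pi^{\rho'}_n\|_{\mathrm{TV}}\to 1\quad\text{as }n\to\infty,$$ and the harmonic measures $\nu_{\pi^\rho}$ and $\nu_{\pi^{\rho'}}$ on $(\partial\Gamma)^2$ are mutually singular.
   Context: A probability measure $\mu$ on a word hyperbolic group $\Gamma$ is non-elementary if its support generates, as a group, a non-elementary subgroup (equivalently, one containing a free group of rank greater than one). It has finite first moment if $\sum_{x\in\Gamma}|x|\mu(x)<\infty$ for some (equivalently, every) word norm $|\cdot|$ associated with a finite generating set. For $\rho\in[0,1]$, $\pi^\rho:=\rho\,\mu\times\mu+(1-\rho)\mu_{\mathrm{diag}}$ on $\Gamma\times\Gamma$, where $\mu_{\mathrm{diag}}((x,y))=\mu(x)$ if $x=y$ and $0$ otherwise; $\pi^\rho_n$ is its $n$-fold convolution power on the group $\Gamma\times\Gamma$. The total variation distance of probability measures on a countable set $X$ is $\|\nu_1-\nu_2\|_{\mathrm{TV}}=\sup_{A\subset X}|\nu_1(A)-\nu_2(A)|$. The asymptotic entropy is $h(\pi)=\lim_{n\to\infty}\frac1nH(\pi_n)$, where $H(\lambda)=-\sum_x\lambda(x)\log\lambda(x)$ (with $0\log0=0$). $\partial\Gamma$ is the Gromov boundary. For $\pi=\pi^\rho$, let $\boldsymbol{w}_n=(w_n^{(1)},w_n^{(2)})$ be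 the $\pi$-random walk started at the identity (product of $n$ independent increments with law $\pi$). Since both marginals of $\pi$ equal $\mu$, which is non-elementary, almost surely $w_n^{(i)}$ converges in $\Gamma\cup\partial\Gamma$ to a point $w_\infty^{(i)}\in\partial\Gamma$ for $i=1,2$; the harmonic measure $\nu_\pi$ is the law of $(w_\infty^{(1)},w_\infty^{(2)})$ on $(\partial\Gamma)^2$. *)

(* Defs.v *)
From HB Require Import structures.
From mathcomp Require Import all_boot all_order all_algebra.
From mathcomp Require Import all_classical all_reals all_analysis.

Set Implicit Arguments.
Unset Strict Implicit.
Unset Printing Implicit Defensive.

Import Order.TTheory GRing.Theory Num.Theory.
Import numFieldNormedType.Exports.

Local Open Scope classical_set_scope.
Local Open Scope ring_scope.

Section WordMetric.
Context {G : groupType}.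

Definition word_in (A : set G) (s : seq G) : Prop :=
  forall x, x \in s -> A x \/ A (x^-1)%g.

Definition generated_subgroup (A : set G) : set G :=
  [set g | exists2 s, word_in A s & g = (\prod_(x <- s) x)%g].

Definition generating (S : seq G) : Prop :=
  generated_subgroup [set` S] = [set: G].

Definition word_of_length (S : seq G) (g : G) (n : nat) : Prop :=
  exists s, [/\ word_in [set` S] s, size s = n & g = (\prod_(x <- s) x)%g].

(* The least length of a word in S and S^-1 representing g; the value 0 for an
   element g outside the subgroup generated by S is irrelevant. *)
Definition word_norm (S : seq G) (g : G) : nat :=
  if pselect (exists n, `[< word_of_length S g n >]) is left gS
  then ex_minn gS else 0%N.

Definition word_dist (S : seq G) (x y : G) : nat := word_norm S (x^-1 * y)%g.

Definition reduced_word (I : eqType) (s : seq (I * bool)) : bool :=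
  sorted (fun a b : I * bool => ~~ ((a.1 == b.1) && (a.2 != b.2))) s.

Definition word_eval (I : Type) (f : I -> G) (s : seq (I * bool)) : G :=
  (\prod_(a <- s) (if a.2 then f a.1 else (f a.1)^-1))%g.

(* The family f is a basis of a free subgroup. *)
Definition free_family (I : eqType) (f : I -> G) : Prop :=
  forall s, reduced_word s -> s <> [::] -> word_eval f s <> 1%g.

Definition nonelementary_subgroup (H : set G) : Prop :=
  exists n, (1 < n)%N /\
    exists f : 'I_n -> G, (forall i, H (f i)) /\ free_family f.

End WordMetric.

Section GromovBoundary.
Context (R : realType) {G : groupType}.
Implicit Type S : seq G.

Definition gromov_product S (z x y : G) : R :=
  ((word_dist S x z)%:R + (word_dist S y z)%:R - (word_dist S x y)%:R) / 2.

Definition gromov_hyperbolic S : Prop :=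
  exists delta : R, forall x y z w : G,
    gromov_product S w x y >=
      Num.min (gromov_product S w x z) (gromov_product S w z y) - delta.

(* A group is word hyperbolic when it has such a finite generating set; all its
   finite generating sets then have this property and give the same boundary. *)
Definition hyperbolic_generating S : Prop :=
  generating S /\ gromov_hyperbolic S.

(* (x_i | y_j) tends to infinity as i and j do. *)
Definition gromov_asymptotic S (x y : nat -> G) : Prop :=
  forall M : R, \forall i & j \near \oo, M <= gromov_product S 1%g (x i) (y j).

Definition converges_at_infinity S (x : nat -> G) : Prop :=
  gromov_asymptotic S x x.

Definition boundary_class S (x : nat -> G) : set (nat -> G) :=
  [set y | converges_at_infinity S y /\ gromov_asymptotic S x y].

(* The Gromov boundary: classes of sequences converging at infinity. *)
Record boundary S := Boundary {
  sequences_of :> set (nat -> G) ;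
  _ : exists2 x, converges_at_infinity S x &
        sequences_of = boundary_class S x }.

HB.instance Definition _ S := gen_eqMixin (boundary S).
HB.instance Definition _ S := gen_choiceMixin (boundary S).

(* The compactification of the group by its Gromov boundary. *)
Definition bordification S : Type := (G + boundary S)%type.

HB.instance Definition _ S := gen_eqMixin (bordification S).
HB.instance Definition _ S := gen_choiceMixin (bordification S).

Definition in_group S (g : G) : bordification S := inl g.
Definition in_boundary S (xi : boundary S) : bordification S := inr xi.

Definition representatives S (p : bordification S) : set (nat -> G) :=
  match p with inl g => [set fun=> g] | inr xi => sequences_of xi end.

(* The points p such that liminf (x_i | y_j) >= r for some x representing xi
   and some y representing p; since Gromov products are half-integers,
   liminf >= r just means that eventually (x_i | y_j) >= r. *)
Definition shadow S (xi : boundary S) (r : R) : set (bordification S) :=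
  [set p | exists x y, [/\ sequences_of xi x, representatives p y &
    \forall i & j \near \oo, r <= gromov_product S 1%g (x i) (y j)]].

(* Elements of the group are isolated points. *)
Definition bord_open S : set_system (bordification S) :=
  [set U | forall xi : boundary S, U (in_boundary xi) ->
    exists r, shadow xi r `<=` U].

Lemma le_shadow S (xi : boundary S) (r r' : R) :
  r <= r' -> shadow xi r' `<=` shadow xi r.
Proof.
move=> rr' p [x [y [hx hy [B nB BP]]]]; exists x, y; split=> //.
by exists B => // ij /BP; exact: le_trans.
Qed.

Fact bord_openT S : bord_open (S := S) setT.
Proof. by move=> xi _; exists 0. Qed.

Fact bord_openI S : setI_closed (bord_open (S := S)).
Proof.
move=> U V oU oV xi [/oU [r hr] /oV [r' hr']].
exists (Num.max r r') => p hp; split.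
- by apply: hr; apply: le_shadow hp; rewrite le_max lexx.
- by apply: hr'; apply: le_shadow hp; rewrite le_max lexx orbT.
Qed.

Fact bord_open_bigU S (I : Type) (f : I -> set (bordification S)) :
  (forall i, bord_open (f i)) -> bord_open (\bigcup_i f i).
Proof.
move=> of_ xi [i _ /of_ [r hr]]; exists r => p /hr fp; by exists i.
Qed.

HB.instance Definition _ S := isOpenTopological.Build (bordification S)
  (@bord_openT S) (@bord_openI S) (@bord_open_bigU S).

(* The boundary carries the subspace topology. *)
HB.instance Definition _ S :=
  Topological.copy (boundary S) (initial_topology (@in_boundary S)).

End GromovBoundary.

Section CountableProbability.
Context {R : realType}.

(* A probability measure on a countable set is given by its values on points. *)
Definition is_probability (T : choiceType) (mu : T -> R) : Prop :=
  (forall x, 0 <= mu x) /\ (\esum_(x in [set: T]) (mu x)%:E = 1)%E.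

Definition mass (T : choiceType) (mu : T -> R) (A : set T) : R :=
  fine (\esum_(x in A) (mu x)%:E).

Definition tv_distance (T : choiceType) (mu nu : T -> R) : R :=
  sup [set `|mass mu A - mass nu A| | A in [set: set T]].

(* The library's logarithm satisfies ln 0 = 0. *)
Definition entropy (T : choiceType) (mu : T -> R) : \bar R :=
  \esum_(x in [set: T]) (- (mu x * ln (mu x)))%:E.

Definition convolution (G : groupType) (mu nu : G -> R) (g : G) : R :=
  fine (\esum_(h in [set: G]) (mu h * nu (h^-1 * g)%g)%:E).

Fixpoint convolution_power (G : groupType) (mu : G -> R) (n : nat) : G -> R :=
  if n is m.+1 then convolution (convolution_power mu m) mu
  else fun g => (g == 1%g)%:R.

Definition asymptotic_entropy (G : groupType) (mu : G -> R) : \bar R :=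
  limn (fun n => ((n%:R)^-1)%:E * entropy (convolution_power mu n))%E.

Definition nonelementary (G : groupType) (mu : G -> R) : Prop :=
  nonelementary_subgroup (generated_subgroup [set x | mu x != 0]).

Definition finite_first_moment (G : groupType) (mu : G -> R) : Prop :=
  exists2 S : seq G, generating S &
    (\esum_(x in [set: G]) ((word_norm S x)%:R * mu x)%:E < +oo)%E.

Definition diagonal_mass (T : choiceType) (mu : T -> R) (z : T * T) : R :=
  if z.1 == z.2 then mu z.1 else 0.

(* The measure pi^rho. *)
Definition noise (T : choiceType) (rho : R) (mu : T -> R) (z : T * T) : R :=
  rho * (mu z.1 * mu z.2) + (1 - rho) * diagonal_mass mu z.

End CountableProbability.

Section RandomWalk.
Context {R : realType} d (Omega : measurableType d) (P : probability Omega R).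

Definition has_law (T : choiceType) (X : Omega -> T) (mu : T -> R) : Prop :=
  forall A : set T, measurable (X @^-1` A) /\
    (P (X @^-1` A) = \esum_(x in A) (mu x)%:E)%E.

Definition independent (T : Type) (X : nat -> Omega -> T) : Prop :=
  forall (J : seq nat) (A : nat -> set T), uniq J ->
    (P (\bigcap_(j in [set` J]) (X j @^-1` A j)) =
       \prod_(j <- J) P (X j @^-1` A j))%E.

Definition random_walk (G : groupType) (mu : G -> R)
    (w : nat -> Omega -> G) : Prop :=
  exists X : nat -> Omega -> G,
    [/\ forall n, has_law (X n) mu, independent X &
        forall n omega, w n omega = (\prod_(i < n) X i omega)%g].

End RandomWalk.

Definition Borel (T : topologicalType) : set (set T) := <<s @open T >>.

Definition mutually_singular (R : realType) (T : topologicalType)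
    (nu nu' : set T -> \bar R) : Prop :=
  exists A, [/\ Borel A, nu A = 0%E & nu' (~` A) = 0%E].

(* nu is the law of the limit (w_infty^(1), w_infty^(2)) of a pi-random walk,
   which is defined up to a null event; only the values of nu on Borel sets
   matter.  The library's measurable types are pointed, whereas the boundary of
   an arbitrary group may be empty, so nu is a set function on Borel sets. *)
Definition harmonic_measure (R : realType) (G : groupType) (S : seq G)
    (pi : G * G -> R)
    (nu : set (boundary R S * boundary R S) -> \bar R) : Prop :=
  exists d (Omega : measurableType d) (P : probability Omega R)
    (w : nat -> Omega -> G * G) (winf : Omega -> boundary R S * boundary R S),
    [/\ random_walk P pi w,
        {ae P, forall omega,
           (in_group R S (w n omega).1 @[n --> \oo] -->
              in_boundary (winf omega).1) /\
           (in_group R S (w n omega).2 @[n --> \oo] -->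
              in_boundary (winf omega).2)},
        forall A, Borel A -> measurable (winf @^-1` A) &
        forall A, Borel A -> nu A = P (winf @^-1` A)].

(* Main.v *)
(* Write p_n for the law of the walk at time n.  A function f_n >= 0 of the
   position that is subadditive along the walk satisfies f_n / n -> l =
   inf E f_n / n in probability: it is bounded by an i.i.d. sum over long
   blocks, the lower tail of that sum is controlled by Chernoff, and the means
   of f_n and of the sum almost agree.  Applied to f_n = - ln p_n, this shows
   that p_n is carried up to a small mass by exp (n (h + e)) points, while the
   law of a walk of entropy h' > h gives each point at most exp (- n (h' - e));
   hence the total variation distance tends to 1.

   For the harmonic measures one reads off the position from the limit point.
   By subadditivity the mean of |w_n| - (w_n | w_m), which is
   (E |w_n| + E |w_(m-n)| - E |w_m|) / 2, is o(n) for arbitrarily large m, and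
   letting m tend to infinity gives (w_n | w_infty) >= |w_n| - o(n) with
   probability close to 1.  Both walks have marginals mu, hence the same drift
   l in each coordinate, so that the limit determines w_n up to distance o(n).
   The limits seen from the exp (n (h + e)) typical positions of the first walk
   thus form an open set of almost full measure for the first walk and, as
   balls of radius o(n) have exp (o(n)) elements, of almost zero measure for
   the second; Borel-Cantelli concludes. *)

(* Convergence in probability is enough throughout: for the singularity, [e] is taken of order 2^-k
   and then a time depending on k, so that the errors become summable and no almost sure ergodic
   theorem enters. A first moment is enough for concentration because a sum of independent
   nonnegative terms has an exponentially small lower tail without any exponential moment, while the
   upper tail is recovered by comparing means. The finiteness of the means of - ln p_n also comes
   from the first moment, by Gibbs' inequality against a weight exp (- c |x|), which is summable
   since groups grow at most exponentially. On the boundary the obstacle is that shadows need not be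
   open, whereas singularity asks for Borel sets. Passing to open sets costs fixed multiples of
   delta, which is harmless since the distances in play are of order n e and only multiply
   cardinalities by exp (O(n e)). Drift zero is no special case: the estimates then hold with
   shadows of negative parameter. *)
Require Import Defs.
From HB Require Import structures.
From mathcomp Require Import all_boot all_order all_algebra.
From mathcomp Require Import finmap all_classical all_reals all_analysis.
From mathcomp Require Import lra ring.

Set Implicit Arguments.
Unset Strict Implicit.
Unset Printing Implicit Defensive.

Import Order.TTheory GRing.Theory Num.Theory.
Import numFieldNormedType.Exports.

Local Open Scope classical_set_scope.
Local Open Scope ring_scope.

(** * Sums and means over countable sets *)

Section Esum.
Context {R : realType}.
Local Open Scope ereal_scope.

Lemma esumZl (T : choiceType) (I : set T) (c : \bar R) (a : T -> \bar R) :
  0 <= c -> (forall i, 0 <= a i) ->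
  \esum_(i in I) (c * a i) = c * \esum_(i in I) a i.
Proof.
move=> c0 a0.
(* The reverse inequality is this one for [r^-1] and the family [r%:E * a i]. *)
have le_real (r : R) (b : T -> \bar R) : (0 < r)%R -> (forall i, 0 <= b i) ->
    \esum_(i in I) (r%:E * b i) <= r%:E * \esum_(i in I) b i.
  move=> r0 b0; apply: ge_ereal_sup => /= _ [X [finX XI]] <-.
  rewrite -ge0_mule_fsumr//; apply: lee_wpmul2l; first by rewrite lee_fin ltW.
  by apply: ereal_sup_ubound; exists X.
case: c c0 => [r r0| _|//].
  move: r0; rewrite lee_fin le_eqVlt => /predU1P[<-|r0].
    by rewrite mul0e esum1// => i _; rewrite mul0e.
  apply/eqP; rewrite eq_le le_real//=.
  rewrite -lee_pdivlMl//.
  have {1}-> : a = (fun i => (r^-1)%:E * (r%:E * a i)).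
    by apply/funext => i; rewrite muleA -EFinM mulVf ?gt_eqF// mul1e.
  by apply: le_real; [rewrite invr_gt0|move=> i; rewrite mule_ge0// lee_fin ltW].
have [[i [Ii ai]]|nai] := pselect (exists i, I i /\ 0 < a i); last first.
  have az i : I i -> a i = 0.
    move=> Ii; apply/eqP; rewrite eq_le a0 andbT leNgt; apply/negP => ai.
    by apply: nai; exists i.
  by rewrite [X in _ * X]esum1// mule0 esum1// => i /az ->; rewrite mule0.
have le1 (b : T -> \bar R) : (forall i, 0 <= b i) -> b i <= \esum_(i in I) b i.
  move=> b0; apply: ereal_sup_ubound; exists [set i].
    by split; [exact: finite_set1|move=> _ ->].
  by rewrite fsbig_set1.
have la : 0 < \esum_(i in I) a i by apply: lt_le_trans ai _; exact: le1.
rewrite gt0_mulye//; apply/eqP; rewrite -leye_eq.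
apply: le_trans (le1 (fun i => +oo * a i) _); first by rewrite gt0_mulye.
by move=> j; rewrite mule_ge0.
Qed.

Lemma esum_exchange (T T' : choiceType) (I : set T) (J : set T')
    (a : T -> T' -> \bar R) : (forall i j, 0 <= a i j) ->
  \esum_(i in I) \esum_(j in J) a i j = \esum_(j in J) \esum_(i in I) a i j.
Proof.
move=> a0; rewrite esum_esum// esum_esum//.
rewrite (reindex_esum (J `*`` fun=> I) _ (fun x => (x.2, x.1)))//; split=> //=.
- by move=> [i j] [/=].
- by move=> [i1 i2] [j1 j2] /= _ _ [] -> ->.
- by move=> [i1 i2] [Pi1 Qi2] /=; exists (i2, i1).
Qed.

Lemma esum_le_set (T : choiceType) (I J : set T) (a : T -> \bar R) :
  (forall i, 0 <= a i) -> I `<=` J ->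
  \esum_(i in I) a i <= \esum_(i in J) a i.
Proof.
move=> a0 IJ; rewrite [leLHS]esum_mkcond [leRHS]esum_mkcond.
apply: le_esum => i _; case: ifPn => [|_]; last by case: ifP.
by rewrite inE => /IJ; rewrite -inE => ->.
Qed.

Lemma le_esum1 (T : choiceType) (I : set T) (a : T -> \bar R) i :
  (forall i, 0 <= a i) -> I i -> a i <= \esum_(i in I) a i.
Proof.
move=> a0 Ii; rewrite -[leLHS](@esum_set1 _ _ i)//.
by apply: esum_le_set => // _ ->.
Qed.

End Esum.

Section Mean.
Context {R : realType}.
Local Open Scope ereal_scope.

Definition mean (T : choiceType) (p : T -> R) (F : T -> \bar R) : \bar R :=
  \esum_(x in [set: T]) ((p x)%:E * F x).

Definition ind {T : Type} (A : set T) (x : T) : \bar R := (\1_A x)%:E.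

Lemma ind_ge0 (T : Type) (A : set T) x : 0 <= ind A x.
Proof. by rewrite lee_fin indicE. Qed.

Lemma ind1 (T : Type) (A : set T) x : A x -> ind A x = 1.
Proof. by move=> Ax; rewrite /ind indicE mem_set. Qed.

Lemma ind0 (T : Type) (A : set T) x : ~ A x -> ind A x = 0.
Proof. by move=> Ax; rewrite /ind indicE memNset. Qed.

Lemma indP (T : Type) (A : set T) x :
  A x /\ ind A x = 1 \/ ~ A x /\ ind A x = 0.
Proof.
by have [Ax|Ax] := pselect (A x); [left; rewrite ind1|right; rewrite ind0].
Qed.

Lemma ind_le (T T' : Type) (A : set T) (B : set T') x y :
  (A x -> B y) -> ind A x <= ind B y.
Proof.
move=> AB; have [Ax|Ax] := pselect (A x); first by rewrite !ind1//; exact: AB.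
by rewrite ind0// ind_ge0.
Qed.

Section weights.
Context (T : choiceType) (p : T -> R) (p0 : forall x, (0 <= p x)%R).

Lemma mean_ge0 F : (forall x, 0 <= F x) -> 0 <= mean p F.
Proof. by move=> F0; apply: esum_ge0 => x _; rewrite mule_ge0// lee_fin. Qed.

(** Restricting the hypothesis to the support matters: where [p_ n x] vanishes, - ln (p_ n x) takes
    the default value 0 and need not be subadditive. *)
Lemma le_mean F F' : (forall x, p x != 0%R -> F x <= F' x) ->
  mean p F <= mean p F'.
Proof.
move=> FF'; apply: le_esum => x _; have [->|px] := eqVneq (p x) 0%R.
  by rewrite !mul0e.
by apply: lee_wpmul2l; [rewrite lee_fin|exact: FF'].
Qed.

Lemma eq_mean F F' : (forall x, p x != 0%R -> F x = F' x) ->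
  mean p F = mean p F'.
Proof.
by move=> FF'; apply/eqP; rewrite eq_le; apply/andP; split; apply: le_mean => x /FF' ->.
Qed.

Lemma meanD F F' : (forall x, 0 <= F x) -> (forall x, 0 <= F' x) ->
  mean p (fun x => F x + F' x) = mean p F + mean p F'.
Proof.
move=> F0 F'0; rewrite /mean -esumD.
- by apply: eq_esum => x _; rewrite ge0_muleDr.
- by move=> x _; rewrite mule_ge0// lee_fin.
- by move=> x _; rewrite mule_ge0// lee_fin.
Qed.

Lemma meanZ c F : 0 <= c -> (forall x, 0 <= F x) ->
  mean p (fun x => c * F x) = c * mean p F.
Proof.
move=> c0 F0; rewrite /mean -esumZl//; first by apply: eq_esum => x _; rewrite muleCA.
by move=> x; rewrite mule_ge0// lee_fin.
Qed.

Lemma mean_ind A : mean p (ind A) = \esum_(x in A) (p x)%:E.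
Proof.
rewrite [RHS]esum_mkcond; apply: eq_esum => x _.
by rewrite /ind indicE; case: (x \in A); rewrite ?mule1 ?mule0.
Qed.

End weights.

Section proba.
Context (T : choiceType) (p : T -> R) (pp : is_probability p).

Lemma prob_ge0 x : (0 <= p x)%R. Proof. by case: pp. Qed.
Hint Resolve prob_ge0 : core.

Lemma prob_le1 x : (p x <= 1)%R.
Proof.
rewrite -lee_fin; case: pp => _ <-.
by apply: (@le_esum1 _ _ _ (fun x => (p x)%:E)) => // i; rewrite lee_fin prob_ge0.
Qed.

Lemma mean_cst c : 0 <= c -> mean p (fun=> c) = c.
Proof.
move=> c0; case: pp => _ h.
under [LHS]eq_esum do rewrite muleC.
by rewrite esumZl ?h ?mule1// => i; rewrite lee_fin prob_ge0.
Qed.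

Lemma mean_ind_le1 A : mean p (ind A) <= 1.
Proof.
rewrite -[leRHS]mean_cst//; apply: le_mean => // x _.
by rewrite lee_fin indicE lern1 leq_b1.
Qed.

Lemma mean_ind_fin A : mean p (ind A) \is a fin_num.
Proof.
rewrite ge0_fin_numE; last by apply: mean_ge0 => // x; exact: ind_ge0.
by apply: le_lt_trans (mean_ind_le1 A) _; rewrite ltry.
Qed.

Lemma mean_indE A : mean p (ind A) = (mass p A)%:E.
Proof. by rewrite /mass -mean_ind fineK// mean_ind_fin. Qed.

End proba.

Section convolution.
Context (G : groupType).
Implicit Types p q : G -> R.

Lemma convolutionE p q g : is_probability p -> is_probability q ->
  (convolution p q g)%:E = \esum_(h in [set: G]) (p h * q (h^-1 * g)%g)%:E.
Proof.
move=> pp qp; rewrite fineK// ge0_fin_numE; last first.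
  by apply: esum_ge0 => h _; rewrite lee_fin mulr_ge0// prob_ge0.
apply: (@le_lt_trans _ _ 1); last by rewrite ltry.
case: (pp) => _ <-; apply: le_esum => h _; rewrite lee_fin.
by rewrite ler_piMr ?prob_ge0 ?prob_le1.
Qed.

Lemma mean_convolution p q F : is_probability p -> is_probability q ->
  (forall x, 0 <= F x) ->
  mean (convolution p q) F = mean p (fun x => mean q (fun y => F (x * y)%g)).
Proof.
move=> pp qp F0; have p0 := prob_ge0 pp; have q0 := prob_ge0 qp.
have pq0 h g : 0 <= (p h * q (h^-1 * g)%g)%:E by rewrite lee_fin mulr_ge0.
transitivity (\esum_(g in [set: G]) \esum_(h in [set: G])
    (F g * (p h * q (h^-1 * g)%g)%:E)).
  by apply: eq_esum => g _; rewrite esumZl// -convolutionE// muleC.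
rewrite esum_exchange; last by move=> *; rewrite mule_ge0.
apply: eq_esum => h _; rewrite -esumZl.
- rewrite (reindex_esum setT _ (fun y => h * y)%g); last first.
    split => //; first by move=> x y _ _; exact: mulgI.
    by move=> y _; exists (h^-1 * y)%g => //; rewrite mulVKg.
  by apply: eq_esum => y _; rewrite mulKg EFinM muleC muleA.
- by rewrite lee_fin.
- by move=> y; rewrite mule_ge0// lee_fin.
Qed.

Lemma is_probabilityE (T : choiceType) (p : T -> R) :
  (forall x, (0 <= p x)%R) -> mean p (fun=> 1) = 1 -> is_probability p.
Proof.
by move=> p0; rewrite /mean; under eq_esum do rewrite mule1; split.
Qed.

Lemma convolution_is_probability p q : is_probability p -> is_probability q ->
  is_probability (convolution p q).
Proof.
move=> pp qp; apply: is_probabilityE => [x|].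
  rewrite -lee_fin convolutionE//; apply: esum_ge0 => h _.
  by rewrite lee_fin mulr_ge0// prob_ge0.
rewrite mean_convolution// -[RHS](mean_cst pp)//.
by apply: eq_mean => [|x _]; [exact: prob_ge0|exact: mean_cst].
Qed.

Lemma mean_dirac (g : G) F : (forall x, 0 <= F x) ->
  mean (fun x => (x == g)%:R) F = F g.
Proof.
move=> F0; rewrite -[RHS](@esum_set1 _ _ g)// [RHS]esum_mkcond.
apply: eq_esum => x _; rewrite -[x == g]/(x == g).
case: ifPn; first by rewrite inE => /= ->; rewrite eqxx mul1e.
by rewrite notin_setE /= => /eqP/negPf ->; rewrite mul0e.
Qed.

Context (p : G -> R) (pp : is_probability p).
Local Notation p_ := (convolution_power p).

Lemma convolution_power_prob n : is_probability (p_ n).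
Proof.
elim: n => [|n IH] /=; last exact: convolution_is_probability.
by apply: is_probabilityE => [x|]; rewrite ?ler0n// mean_dirac.
Qed.

Lemma convolution_power_ge0 n x : (0 <= p_ n x)%R.
Proof. exact/prob_ge0/convolution_power_prob. Qed.
Hint Resolve convolution_power_ge0 convolution_power_prob : core.

Lemma mean_convolution_powerD n m F : (forall x, 0 <= F x) ->
  mean (p_ (n + m)) F =
  mean (p_ n) (fun x => mean (p_ m) (fun y => F (x * y)%g)).
Proof.
elim: m n F => [|m IH] n F F0.
  by rewrite addn0; apply: eq_mean => // x _; rewrite /= mean_dirac// mulg1.
rewrite addnS /= mean_convolution// IH; last first.
  by move=> x; apply: mean_ge0 => //; exact: prob_ge0.
apply: eq_mean => // x _; rewrite mean_convolution//.
apply: eq_mean => // y _; apply: eq_mean => [|z _]; first exact: prob_ge0.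
by rewrite mulgA.
Qed.

Lemma convolution_power1 F : (forall x, 0 <= F x) -> mean (p_ 1) F = mean p F.
Proof.
move=> F0; rewrite /= mean_convolution// ?mean_dirac//; last exact: (convolution_power_prob 0).
- by apply: eq_mean => [|y _]; [exact: prob_ge0|rewrite mul1g].
- by move=> x; apply: mean_ge0 => //; exact: prob_ge0.
Qed.

(** Keep a single term of the convolution sum. This is the source of the subadditivity of - ln
    p_n. *)
Lemma convolution_powerM n m x y :
  (p_ n x * p_ m y <= p_ (n + m) (x * y)%g)%R.
Proof.
rewrite -lee_fin.
have -> : (p_ (n + m) (x * y)%g)%:E = mean (p_ (n + m)) (ind [set (x * y)%g]).
  by rewrite mean_ind esum_set1// lee_fin.
rewrite mean_convolution_powerD; last by move=> ?; exact: ind_ge0.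
apply: le_trans (@le_esum1 _ _ _ _ x _ _) => //.
  rewrite EFinM; apply: lee_wpmul2l; first by rewrite lee_fin.
  apply: le_trans (@le_esum1 _ _ _ _ y _ _) => //.
    by rewrite ind1// mule1.
  by move=> z; rewrite mule_ge0 ?ind_ge0 ?lee_fin.
move=> z; rewrite mule_ge0 ?lee_fin//; apply: mean_ge0 => // ?; exact: ind_ge0.
Qed.

End convolution.
End Mean.

(** * Independent samples *)

Section Products.
Context {R : realType}.
Local Open Scope ereal_scope.

Definition prod_weight (T T' : choiceType) (p : T -> R) (q : T' -> R)
  (z : T * T') : R := (p z.1 * q z.2)%R.

Lemma mean_prod (T T' : choiceType) (p : T -> R) (q : T' -> R) F :
  (forall x, (0 <= p x)%R) -> (forall x, (0 <= q x)%R) -> (forall z, 0 <= F z) ->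
  mean (prod_weight p q) F = mean p (fun x => mean q (fun y => F (x, y))).
Proof.
move=> p0 q0 F0; rewrite /mean.
under [RHS]eq_esum => x _.
  rewrite -esumZl; [|by rewrite lee_fin|by move=> y; rewrite mule_ge0// lee_fin].
  over.
rewrite esum_esum; last by move=> x y _ _; rewrite !mule_ge0// lee_fin.
have -> : [set: T] `*`` (fun=> [set: T']) = setT by apply/seteqP; split.
by apply: eq_esum => -[x y] _ /=; rewrite EFinM muleA.
Qed.

Lemma prod_weight_prob (T T' : choiceType) (p : T -> R) (q : T' -> R) :
  is_probability p -> is_probability q -> is_probability (prod_weight p q).
Proof.
move=> pp qp; have p0 := prob_ge0 pp; have q0 := prob_ge0 qp.
apply: is_probabilityE => [x|]; first exact: mulr_ge0.
rewrite mean_prod// -[RHS](mean_cst pp)//.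
by apply: eq_mean => // x _; exact: mean_cst.
Qed.

(** A sample of size [k] is a weight on all lists, vanishing on those of the wrong length, so that
    means are computed by recursion on [k] without dependent types. *)
Fixpoint iid (T : choiceType) (q : T -> R) (k : nat) (s : seq T) : R :=
  match k, s with
  | 0%N, [::] => 1%R
  | k'.+1, x :: s' => (q x * iid q k' s')%R
  | _, _ => 0%R
  end.

Section iid.
Context (T : choiceType) (q : T -> R) (qp : is_probability q).

Lemma iid_ge0 k s : (0 <= iid q k s)%R.
Proof.
by elim: k s => [|k IH] [|x s] //=; rewrite mulr_ge0// (prob_ge0 qp).
Qed.
Hint Resolve iid_ge0 : core.

Lemma mean_iid0 F : (forall s, 0 <= F s) -> mean (iid q 0) F = F [::].
Proof.
move=> F0; rewrite -[RHS](@esum_set1 _ _ [::])// [RHS]esum_mkcond.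
apply: eq_esum => -[|x s] _ /=.
  by rewrite mem_set// mul1e.
by rewrite memNset ?mul0e.
Qed.

Lemma mean_iidS k F : (forall s, 0 <= F s) ->
  mean (iid q k.+1) F = mean q (fun x => mean (iid q k) (fun s => F (x :: s))).
Proof.
move=> F0; rewrite -(@mean_prod _ _ _ _ (fun z => F (z.1 :: z.2)))//; last exact: prob_ge0.
rewrite /mean [LHS](_ : _ = \esum_(s in range (fun z : T * seq T => z.1 :: z.2))
   ((iid q k.+1 s)%:E * F s)); last first.
  rewrite [RHS]esum_mkcond; apply: eq_esum => -[|x s] _.
    by rewrite memNset ?mul0e// => -[[]].
  by rewrite mem_set//; exists (x, s).
rewrite esum_image; last by move=> [x s] [y t] _ _ [-> ->].
by [].
Qed.

Lemma iid_prob k : is_probability (iid q k).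
Proof.
elim: k => [|k IH]; first by apply: is_probabilityE => //; rewrite mean_iid0.
apply: is_probabilityE => //; rewrite mean_iidS// -[RHS](mean_cst qp)//.
by apply: eq_mean => [|x _]; [exact: prob_ge0|exact: mean_cst].
Qed.

Lemma mean_iid_prod k (phi : T -> R) c :
  (forall x, (0 <= phi x)%R) -> mean q (EFin \o phi) = c%:E ->
  mean (iid q k) (fun s => (\prod_(x <- s) phi x)%:E) = (c ^+ k)%:E.
Proof.
have q0 := prob_ge0 qp.
move=> phi0 mc; elim: k => [|k IH].
  by rewrite mean_iid0 ?big_nil// => s; rewrite lee_fin prodr_ge0.
have F0 s : (0 <= \prod_(x <- s) phi x)%R by exact: prodr_ge0.
rewrite mean_iidS => [|s]; last by rewrite lee_fin.
transitivity (mean q (fun x => (c ^+ k)%:E * (phi x)%:E)).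
  apply: eq_mean => // x _; rewrite muleC -IH -meanZ// ?lee_fin//.
  by apply: eq_mean => // s _; rewrite big_cons EFinM.
have c0 : (0 <= c)%R by rewrite -lee_fin -mc; apply: mean_ge0 => // x; rewrite lee_fin.
rewrite meanZ// ?lee_fin ?exprn_ge0//.
by rewrite [X in _ * X = _]mc -EFinM exprSr.
Qed.

Lemma mean_iid_sum k (phi : T -> R) c :
  (forall x, (0 <= phi x)%R) -> mean q (EFin \o phi) = c%:E ->
  mean (iid q k) (fun s => (\sum_(x <- s) phi x)%:E) = (c *+ k)%:E.
Proof.
have q0 := prob_ge0 qp.
move=> phi0 mc; have F0 s : (0 <= \sum_(x <- s) phi x)%R by exact: sumr_ge0.
elim: k => [|k IH]; first by rewrite mean_iid0 ?big_nil// => s; rewrite lee_fin.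
rewrite mean_iidS => [|s]; last by rewrite lee_fin.
have ck : (0 <= c *+ k)%R.
  by rewrite mulrn_wge0// -lee_fin -mc; apply: mean_ge0 => // x; rewrite lee_fin.
transitivity (mean q (fun x => (phi x)%:E + (c *+ k)%:E)).
  apply: eq_mean => // x _; rewrite -IH -[X in X + _](mean_cst (iid_prob k)) ?lee_fin//.
  rewrite -meanD; [|exact: iid_ge0|by move=> s; rewrite lee_fin..].
  by apply: eq_mean => // s _; rewrite big_cons EFinD.
by rewrite meanD// mean_cst// [X in X + _ = _]mc -EFinD mulrS.
Qed.

(** The mean is a supremum of finite sums, so some finite set already carries more than [m]; [Y'] is
    [Y] cut off outside it, hence bounded. *)
Lemma truncated_mean (Y : T -> R) (m : R) : (forall x, (0 <= Y x)%R) ->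
  m%:E < mean q (EFin \o Y) ->
  exists Y' : T -> R, exists M u : R,
   [/\ forall x, (0 <= Y' x <= Y x)%R, forall x, (Y' x <= M)%R,
      mean q (EFin \o Y') = u%:E & (m <= u)%R].
Proof.
move=> Y0 /ereal_sup_gt[_ [X [finX _] <-] mX].
have q0 := prob_ge0 qp.
pose Y' x := if x \in X then Y x else 0%R.
exists Y', (\sum_(x <- fset_set X) Y x)%R.
have Y'0 x : (0 <= Y' x)%R by rewrite /Y'; case: ifP.
have Y'M x : (Y' x <= \sum_(x <- fset_set X) Y x)%R.
  rewrite /Y'; case: ifPn => [xX|_]; last exact: sumr_ge0.
  rewrite (big_fsetD1 x) /=; last by rewrite in_fset_set.
  by rewrite lerDl sumr_ge0.
have fY' : mean q (EFin \o Y') \is a fin_num.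
  rewrite ge0_fin_numE; last by apply: mean_ge0 => // x; rewrite lee_fin.
  apply: (@le_lt_trans _ _ (\sum_(x <- fset_set X) Y x)%R%:E); last exact: ltry.
  rewrite -[leRHS](mean_cst qp); last by rewrite lee_fin sumr_ge0.
  by apply: le_mean => // x _; rewrite lee_fin.
exists (fine (mean q (EFin \o Y'))); split=> //.
- by move=> x; rewrite Y'0 /=/Y'; case: ifP.
- by rewrite fineK.
- rewrite -lee_fin fineK// (le_trans (ltW mX))//.
  apply: esum_ge; exists X; first by split.
  by apply: lee_fsum => // x Xx; rewrite /= /Y' mem_set.
Qed.

(** Truncation only lowers [Y], so the lower tail may be estimated for a bounded [Y'], by Markov's
    inequality for the exponential of [- t * Y']. In particular [Y] may have infinite mean. *)
Lemma chernoff_lower (Y : T -> R) (m e : R) : (forall x, (0 <= Y x)%R) ->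
  (0 < e)%R -> m%:E <= mean q (EFin \o Y) ->
  exists theta : R, (0 <= theta < 1)%R /\ forall k,
    mean (iid q k) (ind [set s | (\sum_(x <- s) Y x < k%:R * (m - e))%R])
     <= (theta ^+ k)%:E.
Proof.
move=> Y0 e0 mY; have q0 := prob_ge0 qp.
have [|Y' [M [u [Y'Y Y'M mu um]]]] := @truncated_mean Y (m - e / 2) Y0.
  by apply: lt_le_trans mY; rewrite lte_fin; lra.
have Y'0 x : (0 <= Y' x)%R by case/andP: (Y'Y x).
have Y'leY x : (Y' x <= Y x)%R by case/andP: (Y'Y x).
(* Makes the quadratic error t^2 M^2 at most t e / 4. Truncation costs t e / 2 out of t e, so the
   exponent keeps a margin t e / 4. *)
pose D : R := (4 * (M ^+ 2 + 1))%R.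
have D0 : (0 < D)%R by rewrite /D mulr_gt0// ltr_wpDl// sqr_ge0.
pose t := (e / D)%R.
have t0 : (0 < t)%R by rewrite divr_gt0.
have tM : (t ^+ 2 * M ^+ 2 <= t * (e / 4))%R.
  rewrite expr2 -mulrA ler_pM2l//.
  rewrite /t mulrAC ler_pdivrMr// /D; have := sqr_ge0 M; nra.
exists (expR (- (t * (e / 4)))); split.
  by rewrite expR_ge0 /= -expR0 ltr_expR oppr_lt0 mulr_gt0// divr_gt0.
pose phi x := expR (- (t * Y' x)).
have phi0 x : (0 <= phi x)%R by exact: expR_ge0.
have phi1 x : (phi x <= 1)%R by rewrite -expR0 ler_expR oppr_le0 mulr_ge0// ltW.
have fphi : mean q (EFin \o phi) \is a fin_num.
  rewrite ge0_fin_numE; last by apply: mean_ge0 => // x; rewrite lee_fin.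
  apply: (@le_lt_trans _ _ 1); last exact: ltry.
  rewrite -[leRHS](mean_cst qp)//.
  by apply: le_mean => // x _; rewrite lee_fin.
pose c := fine (mean q (EFin \o phi)).
have mc : mean q (EFin \o phi) = c%:E by rewrite fineK.
have c0 : (0 <= c)%R by rewrite -lee_fin -mc; apply: mean_ge0 => // x; rewrite lee_fin.
have cle : (c <= expR (- (t * u) + t ^+ 2 * M ^+ 2))%R.
  (* From exp (- y) <= 1 / (1 + y) and (1 - y + y^2) (1 + y) = 1 + y^3. *)
  have exp_le (y : R) : (0 <= y)%R -> (expR (- y) + y <= 1 + y ^+ 2)%R.
    move=> y0; rewrite expRN -lerBrDr.
    have y1 : (0 < 1 + y)%R by lra.
    apply: (@le_trans _ _ (1 + y)^-1)%R.
      by rewrite lef_pV2 ?posrE ?expR_gt0// expR_ge1Dx.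
    rewrite -div1r ler_pdivrMr//.
    have : (0 <= y ^+ 3)%R by exact: exprn_ge0.
    rewrite !exprS expr0; nra.
  apply: le_trans (expR_ge1Dx _).
  suff : (c + t * u <= 1 + t ^+ 2 * M ^+ 2)%R by lra.
  rewrite -lee_fin EFinD EFinM -mc -mu.
  rewrite -meanZ ?lee_fin ?(ltW t0)//.
  rewrite -meanD; [|exact: q0|by move=> x; rewrite lee_fin|]; last first.
    by move=> x; rewrite mule_ge0// lee_fin// ltW.
  rewrite -[leRHS](mean_cst qp); last by rewrite lee_fin addr_ge0// mulr_ge0// sqr_ge0.
  apply: le_mean => // x _; rewrite /= -EFinM -EFinD lee_fin.
  apply: (le_trans (exp_le _ _)); first by rewrite mulr_ge0// ltW.
  rewrite lerD2l exprMn ler_wpM2l ?sqr_ge0//.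
  by rewrite ler_pXn2r ?nnegrE// (le_trans (Y'0 x)).
move=> k.
apply: (@le_trans _ _ (mean (iid q k) (fun s =>
    (expR (t * (k%:R * (m - e))))%:E * (\prod_(x <- s) phi x)%:E))).
  apply: le_mean => // s _.
  have [h|h] := pselect (\sum_(x <- s) Y x < k%:R * (m - e))%R; last first.
    by rewrite ind0//= mule_ge0// lee_fin ?expR_ge0// prodr_ge0.
  rewrite ind1// -EFinM lee_fin.
  have -> : (\prod_(x <- s) phi x = expR (- (t * \sum_(x <- s) Y' x)))%R.
    rewrite mulr_sumr -sumrN; elim: (s) => [|x s' IH]; first by rewrite !big_nil expR0.
    by rewrite !big_cons expRD IH.
  rewrite -expRD -[leLHS]expR0 ler_expR -mulrN -mulrDr mulr_ge0 ?(ltW t0)//.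
  rewrite subr_ge0; apply: le_trans (ltW h); exact: ler_sum.
rewrite meanZ ?lee_fin ?expR_ge0//; last by move=> s; rewrite lee_fin prodr_ge0.
rewrite (mean_iid_prod k phi0 mc) -EFinM lee_fin.
rewrite -mulrCA mulrC expRM_natl -exprMn lerXn2r ?nnegrE ?mulr_ge0 ?expR_ge0//.
apply: (le_trans (ler_wpM2r (expR_ge0 _) cle)).
rewrite -expRD ler_expR.
have : (t * (m - e / 2) <= t * u)%R by rewrite ler_wpM2l// ltW.
lra.
Qed.

End iid.

Lemma mean_iid_conv (G : groupType) (p : G -> R) N k F : is_probability p ->
  (forall x, 0 <= F x) ->
  mean (iid (convolution_power p N) k) (fun s => F (\prod_(x <- s) x)%g) =
  mean (convolution_power p (k * N)) F.
Proof.
move=> pp; have pNp := convolution_power_prob pp N.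
have p0 := convolution_power_ge0 pp.
elim: k F => [|k IH] F F0.
  by rewrite mean_iid0// mul0n /= mean_dirac// big_nil.
rewrite mean_iidS// mulSn mean_convolution_powerD//.
apply: eq_mean => // x _; rewrite -IH//.
by apply: eq_mean => [|s _]; [exact: iid_ge0|rewrite big_cons].
Qed.

(** The mean of [g] exceeds [L] by at most [e] and [g] is rarely below [L - e], which leaves no room
    for a large upper tail of [g], hence of [f]. And [f] cannot often be far below [g], their means
    being within [e]. Each bound is the mean of a pointwise inequality between indicators. *)
Lemma concentration (T : choiceType) (p : T -> R) (f g : T -> R) (L e d eta : R) :
  is_probability p -> (forall x, (0 <= f x)%R) ->
  (forall x, p x != 0%R -> (f x <= g x)%R) -> (forall x, (0 <= g x)%R) ->
  (0 <= L)%R -> (0 <= e)%R -> (0 < eta)%R -> (e <= eta / 2)%R ->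
  mean p (EFin \o g) <= (L + e)%:E -> L%:E <= mean p (EFin \o f) ->
  mean p (ind [set x | (g x < L - e)%R]) <= d%:E ->
  mean p (ind [set x | (L + eta < f x)%R]) <= ((2 * e + L * d) / eta)%:E /\
  mean p (ind [set x | (f x < L - eta)%R]) <= (2 * e / eta + d)%:E.
Proof.
move=> pp f0 fg g0 L0 e0 eta0 ee mg mf mlow.
have p0 := prob_ge0 pp.
have iR A : mean p (ind A) = (mass p A)%:E by rewrite mean_indE.
have [rg mgE] : exists r, mean p (EFin \o g) = r%:E.
  have : mean p (EFin \o g) \is a fin_num.
    rewrite ge0_fin_numE; last by apply: mean_ge0 => // x; rewrite lee_fin.
    by apply: le_lt_trans mg _; rewrite ltry.
  by exists (fine (mean p (EFin \o g))); rewrite fineK.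
have [rf mfE] : exists r, mean p (EFin \o f) = r%:E.
  have : mean p (EFin \o f) \is a fin_num.
    rewrite ge0_fin_numE; last by apply: mean_ge0 => // x; rewrite lee_fin.
    apply: le_lt_trans (ltry rg); rewrite -mgE.
    by apply: le_mean => // x px; rewrite lee_fin fg.
  by exists (fine (mean p (EFin \o f))); rewrite fineK.
move: mg mf mlow; rewrite mgE mfE !iR !lee_fin => mg mf mlow.
set low := [set x | (g x < L - e)%R] in mlow *.
have eta0' : (0 <= eta)%R := ltW eta0.
have eta20 : (0 <= eta / 2)%R by rewrite divr_ge0.
have ind0' (A : set T) x : 0 <= ind A x by exact: ind_ge0.
split.
- set U := [set x | _].
  have : mean p (fun x => L%:E + eta%:E * ind U x) <=
         mean p (fun x => (g x)%:E + (e%:E + L%:E * ind low x)).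
    apply: le_mean => // x px; have fgx := fg x px.
    have gx := g0 x.
    case: (@indP R _ U x) => -[Ux ->]; case: (@indP R _ low x) => -[lx ->];
      move: Ux lx; rewrite /U /low /= => Ux lx;
      rewrite -!EFinM -!EFinD lee_fin ?mulr0 ?mulr1; lra.
  rewrite !(meanD, meanZ) ?lee_fin//; try by move=> x; rewrite ?adde_ge0 ?mule_ge0 ?ind0' ?lee_fin.
  rewrite !mean_cst ?lee_fin// !iR [mean _ _]mgE -!EFinM -!EFinD lee_fin => h.
  rewrite ler_pdivlMr// mulrC.
  have : (L * mass p low <= L * d)%R by rewrite ler_wpM2l.
  lra.
- set V := [set x | (f x < L - eta)%R].
  have : mean p (fun x => (eta / 2)%:E * ind V x + (f x)%:E) <=
         mean p (fun x => (g x)%:E + (eta / 2)%:E * ind low x).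
    apply: le_mean => // x px; have fgx := fg x px.
    case: (@indP R _ V x) => -[Ux ->]; case: (@indP R _ low x) => -[lx ->];
      move: Ux lx; rewrite /V /low /= => Ux lx;
      rewrite -!EFinM -!EFinD lee_fin ?mulr0 ?mulr1; lra.
  rewrite !(meanD, meanZ) ?lee_fin//; try by move=> x; rewrite ?adde_ge0 ?mule_ge0 ?ind0' ?lee_fin.
  rewrite !iR [mean _ (EFin \o g)]mgE [mean _ (EFin \o f)]mfE -!EFinM -!EFinD lee_fin => h.
  have h1 : (eta * mass p V <= 2 * e + eta * mass p low)%R by lra.
  rewrite -lerBlDr ler_pdivlMr// mulrBl.
  have : (eta * mass p low <= eta * d)%R by rewrite ler_wpM2l// ltW.
  lra.
Qed.

End Products.

(** * Subadditive functions of a random walk *)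

Section Fekete.
Context {R : realType}.
Implicit Type a : nat -> R.

Definition growth_rate a : R := inf [set a n / n%:R | n in [set n | (0 < n)%N]].

Section subadditive.
Context (a : nat -> R) (a0 : forall n, 0 <= a n)
  (a_sub : forall n m, a (n + m)%N <= a n + a m).

Let has_inf_ratio : has_inf [set a n / n%:R | n in [set n | (0 < n)%N]].
Proof.
split; first by exists (a 1 / 1%:R), 1%N.
by exists 0 => _ [n _ <-]; rewrite divr_ge0.
Qed.

Lemma growth_rate_ge0 : 0 <= growth_rate a.
Proof.
apply: lb_le_inf; first by case: has_inf_ratio.
by move=> _ [n _ <-]; rewrite divr_ge0.
Qed.

Lemma growth_rate_le n : n%:R * growth_rate a <= a n.
Proof.
case: n => [|n]; first by rewrite mul0r.
rewrite mulrC -ler_pdivlMr ?ltr0n//; apply: ge_inf; first by case: has_inf_ratio.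
by exists n.+1.
Qed.

Lemma subadditiveM k N r : a (k * N + r)%N <= k%:R * a N + a r.
Proof.
elim: k => [|k IH]; first by rewrite mul0r add0r.
rewrite mulSn -addnA (le_trans (a_sub _ _))//.
by rewrite -natr1 mulrDl mul1r addrAC [leRHS]addrC lerD2l.
Qed.

Lemma growth_rate_block e : 0 < e ->
  exists2 N, (0 < N)%N & a N <= N%:R * (growth_rate a + e).
Proof.
move=> e0; have [_ [N /= N0 <-] h] := inf_adherent e0 has_inf_ratio.
by exists N => //; rewrite mulrC -ler_pdivrMr ?ltr0n// ltW.
Qed.

Lemma growth_rate_near e : 0 < e ->
  \forall n \near \oo, a n <= n%:R * (growth_rate a + e).
Proof.
move=> e0; have [N N0 aN] := growth_rate_block (divr_gt0 e0 (ltr0n _ 2)).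
(* Bounds [a r] for every remainder modulo [N], and is negligible against [n%:R * e]. *)
pose C := \sum_(r < N) a r.
have [B _ HB] := nbhs_infty_ger (2 * C / e).
exists B => // n /HB Cn.
move: (n %/ N)%N (n %% N)%N (divn_eq n N) (ltn_pmod n N0) => k r nE rN.
rewrite [in leLHS]nE (le_trans (subadditiveM _ _ _))//.
have arC : a r <= C.
  rewrite /C (bigD1 (Ordinal rN))//= lerDl; exact: sumr_ge0.
have Ce : C <= n%:R * (e / 2).
  by move: Cn; rewrite ler_pdivrMr//; lra.
have kN : k%:R * N%:R <= n%:R :> R by rewrite -natrM ler_nat nE leq_addr.
have k0 : 0 <= k%:R :> R by [].
have : k%:R * a N <= k%:R * (N%:R * (growth_rate a + e / 2)) by exact: ler_wpM2l.
have : k%:R * N%:R * (growth_rate a + e / 2) <= n%:R * (growth_rate a + e / 2).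
  by rewrite ler_wpM2r// addr_ge0 ?growth_rate_ge0// divr_ge0// ltW.
lra.
Qed.

Lemma growth_rate_cvg : a n / n%:R @[n --> \oo] --> growth_rate a.
Proof.
apply/cvgrPdist_le => e e0; near=> n.
have n0 : (0 < n)%N by near: n; exists 1%N.
rewrite distrC ger0_norm.
  rewrite lerBlDr addrC ler_pdivrMr ?ltr0n// mulrC.
  by near: n; exact: growth_rate_near.
by rewrite subr_ge0 ler_pdivlMr ?ltr0n// mulrC growth_rate_le.
Unshelve. all: by end_near. Qed.

(* Otherwise a would eventually grow strictly slower than its rate along an
   arithmetic progression of difference n. *)
Lemma growth_rate_increment n e M : 0 < e ->
  exists2 m, (M <= m)%N & n%:R * growth_rate a - e <= a (n + m)%N - a m.
Proof.
move=> e0; apply: contrapT => nex.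
have step m : (M <= m)%N -> a (n + m)%N < a m + (n%:R * growth_rate a - e).
  move=> Mm; rewrite -ltrBlDl ltNge; apply/negP => h; apply: nex; by exists m.
have bound j : a (j * n + M)%N <= a M + j%:R * (n%:R * growth_rate a - e).
  elim: j => [|j IH]; first by rewrite mul0r addr0.
  rewrite mulSn -addnA -natr1 mulrDl mul1r addrA.
  by apply: (le_trans (ltW (step _ (leq_addl _ _)))); rewrite lerD2r.
have [j] : exists j, a M < j%:R * e.
  exists (Num.bound (a M / e)); rewrite -ltr_pdivrMr//.
  by apply: le_lt_trans (archi_boundP _); rewrite ?divr_ge0// ltW.
have := growth_rate_le (j * n + M)%N.
have := bound j; rewrite natrD natrM mulrDl mulrBr.
have : 0 <= M%:R * growth_rate a by rewrite mulr_ge0// growth_rate_ge0.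
lra.
Qed.

End subadditive.
End Fekete.

Section Subadditive.
Context {R : realType} (G : groupType) (p : G -> R) (pp : is_probability p).
Local Notation p_ := (convolution_power p).
Context (f : nat -> G -> R) (f0 : forall n x, 0 <= f n x)
  (f_sub : forall n m x y, p_ n x != 0 -> p_ m y != 0 ->
    f (n + m)%N (x * y)%g <= f n x + f m y)
  (f1_fin : (mean (p_ 1) (EFin \o f 1%N) < +oo)%E).

Let p0 n x : 0 <= p_ n x. Proof. exact: convolution_power_ge0. Qed.
Let pp_ n : is_probability (p_ n). Proof. exact: convolution_power_prob. Qed.

Definition expected n : R := fine (mean (p_ n) (EFin \o f n)).

Let mean_sub n m : (mean (p_ (n + m)) (EFin \o f (n + m)%N) <=
  mean (p_ n) (EFin \o f n) + mean (p_ m) (EFin \o f m))%E.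
Proof.
rewrite mean_convolution_powerD//; last by move=> x; rewrite lee_fin.
apply: (@le_trans _ _ (mean (p_ n) (fun x => (f n x)%:E + mean (p_ m) (EFin \o f m)))%E).
  apply: le_mean => // x px.
  rewrite -[X in (X + _)%E](mean_cst (pp_ m)) ?lee_fin//.
  rewrite -meanD//; [|by move=> y; rewrite lee_fin..].
  by apply: le_mean => // y py; rewrite -EFinD lee_fin f_sub.
have m0 : (0 <= mean (p_ m) (EFin \o f m))%E.
  by apply: mean_ge0 => // y; rewrite lee_fin.
rewrite meanD//; last by move=> x; rewrite lee_fin.
by rewrite leeD2l// [leLHS](mean_cst (pp_ n)).
Qed.

(** Finiteness propagates from time one by subadditivity; at time zero the law is a Dirac mass. *)
Lemma expectedE n : mean (p_ n) (EFin \o f n) = (expected n)%:E.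
Proof.
rewrite /expected fineK// ge0_fin_numE; last first.
  by apply: mean_ge0 => // x; rewrite lee_fin.
elim: n => [|n IH]; first by rewrite mean_dirac ?ltry// => x; rewrite lee_fin.
by rewrite -addn1; apply: le_lt_trans (mean_sub n 1) _; exact: lte_add_pinfty.
Qed.

Lemma expected_ge0 n : 0 <= expected n.
Proof. by rewrite fine_ge0//; apply: mean_ge0 => // x; rewrite lee_fin. Qed.

Lemma expected_sub n m : expected (n + m) <= expected n + expected m.
Proof. by rewrite -lee_fin EFinD -!expectedE mean_sub. Qed.

Lemma convolution_power_prod N k s : iid (p_ N) k s != 0 ->
  p_ (k * N) (\prod_(x <- s) x)%g != 0.
Proof.
elim: k s => [|k IH] [|x s] //=; rewrite ?eqxx ?big_nil ?eqxx ?oner_eq0//.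
rewrite mulf_eq0 negb_or big_cons => /andP[px /IH ps].
have := convolution_powerM pp N (k * N) x (\prod_(x <- s) x)%g.
rewrite mulSn; apply: contraTneq => ->; rewrite -ltNge.
by rewrite mulr_gt0// lt_neqAle eq_sym ?px ?ps p0.
Qed.

Lemma block_bound N k r s y : iid (p_ N) k s != 0 -> p_ r y != 0 ->
  f (k * N + r)%N ((\prod_(x <- s) x) * y)%g <= \sum_(x <- s) f N x + f r y.
Proof.
move=> + py; elim: k s => [|k IH] [|x s] //=; rewrite ?eqxx//.
  by rewrite !big_nil mul1g add0r add0n.
rewrite mulf_eq0 negb_or !big_cons => /andP[px ps].
rewrite mulSn -addnA -mulgA -addrA (le_trans (f_sub px _))//.
  have := convolution_powerM pp (k * N) r (\prod_(x <- s) x)%g y.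
  apply: contraTneq => ->; rewrite -ltNge.
  by rewrite mulr_gt0// lt_neqAle eq_sym ?py p0 ?convolution_power_prod.
by rewrite lerD2l IH.
Qed.

Let l := growth_rate expected.

(* The blocks x_1, ..., x_k of length N bound f from above by an i.i.d. sum,
   whose lower tail is controlled by Chernoff; since the mean of the upper
   bound is close to the mean of f, both are concentrated. *)
Theorem subadditive_concentration e : 0 < e -> \forall n \near \oo,
  (mean (p_ n) (ind [set x | n%:R * (l + e) < f n x]%R) <= e%:E)%E /\
  (mean (p_ n) (ind [set x | f n x < n%:R * (l - e)]%R) <= e%:E)%E.
Proof.
move=> e0.
have l0 : 0 <= l := growth_rate_ge0 expected_ge0.
(* [e'] and [d] make both bounds of [concentration], (2 e' + l d) / e and 2 e' / e + d, at most [e].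
   The denominator of [d] has [l + 1] because [l] may vanish. *)
pose e' := Num.min (e / 2) (e ^+ 2 / 4).
pose d := Num.min (e / 2) (e ^+ 2 / (2 * (l + 1))).
have l1 : 0 < 2 * (l + 1) by rewrite mulr_gt0// ltr_wpDl.
have e'0 : 0 < e' by rewrite lt_min !divr_gt0// exprn_gt0.
have d0 : 0 < d by rewrite lt_min !divr_gt0// exprn_gt0.
have e'1 : e' <= e / 2 by rewrite ge_min lexx.
have e'2 : e' <= e ^+ 2 / 4 by rewrite ge_min lexx orbT.
have d1 : d <= e / 2 by rewrite ge_min lexx.
have d2 : l * d <= e ^+ 2 / 2.
  apply: (@le_trans _ _ ((l + 1) * d)); first by rewrite ler_wpM2r ?lerDl// ltW.
  have : d <= e ^+ 2 / (2 * (l + 1)) by rewrite ge_min lexx orbT.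
  by rewrite ler_pdivlMr//; lra.
have [N N0 aN] := growth_rate_block expected_ge0 (divr_gt0 e'0 (ltr0n _ 2)).
have N0' : 0 < N%:R :> R by rewrite ltr0n.
have [theta [/andP[theta0 theta1] chern]] : exists theta : R, 0 <= theta < 1 /\
    forall k, (mean (iid (p_ N) k) (ind [set s | \sum_(x <- s) f N x <
      k%:R * (N%:R * l - N%:R * (e' / 2))])%R <= (theta ^+ k)%:E)%E.
  apply: chernoff_lower => //; first by rewrite mulr_gt0// divr_gt0.
  by rewrite expectedE lee_fin; exact: growth_rate_le expected_ge0 _.
have [K1 _ thetaK] : \forall k \near \oo, theta ^+ k < d.
  have := @cvg_expr R theta; rewrite ger0_norm// => /(_ theta1).
  move=> /cvgrPdist_lt/(_ d d0); apply: filterS => k.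
  by rewrite sub0r normrN ger0_norm// exprn_ge0.
(* With this many blocks, the contribution N l of the incomplete last block is at most half of the
   allowed error k N e'. *)
have [K2 _ kl] : \forall k \near \oo, 2 * l / e' <= k%:R by exact: nbhs_infty_ger.
pose C := \sum_(r < N) expected r.
near=> n.
have n0 : (0 < n)%N by near: n; exists 1%N.
have n0' : 0 < n%:R :> R by rewrite ltr0n.
have nC : 2 * C / e' <= n%:R by near: n; exact: nbhs_infty_ger.
have nK : (N * (K1 + K2) <= n)%N by near: n; exact: nbhs_infty_ge.
have kK : (K1 + K2 <= n %/ N)%N by rewrite leq_divRL// mulnC.
move: (n %/ N)%N (n %% N)%N (divn_eq n N) (ltn_pmod n N0) kK => k r nE rN kK.
have {}thetaK : theta ^+ k < d by apply: thetaK; rewrite /= (leq_trans _ kK)// leq_addr.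
have {}kl : 2 * l / e' <= k%:R by apply: kl; rewrite /= (leq_trans _ kK)// leq_addl.
have arC : expected r <= C.
  by rewrite /C (bigD1 (Ordinal rN))//= lerDl sumr_ge0// => i _; exact: expected_ge0.
(* A coupling: [k] independent blocks of length [N] and a remainder of length [r] multiply to a
   position of law [p_ n], so that [f] and its block bound live on one space. *)
pose W := prod_weight (iid (p_ N) k) (p_ r).
have iid0 := iid_ge0 (pp_ N) k.
have Wp : is_probability W by apply: prod_weight_prob => //; exact: iid_prob.
have W0 := prob_ge0 Wp.
pose F (z : seq G * G) := f n ((\prod_(x <- z.1) x) * z.2)%g.
pose g (z : seq G * G) := \sum_(x <- z.1) f N x + f r z.2.
have transfer H : (forall x, (0 <= H x)%E) -> mean (p_ n) H =
    mean W (fun z => H ((\prod_(x <- z.1) x) * z.2)%g).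
  move=> H0; rewrite mean_prod// nE mean_convolution_powerD//.
  rewrite -(mean_iid_conv N k pp)// => x; exact: mean_ge0.
have sum0 s : 0 <= \sum_(x <- s) f N x by exact: sumr_ge0.
have Fg z : W z != 0 -> F z <= g z.
  rewrite /W /prod_weight mulf_eq0 negb_or => /andP[? ?].
  by rewrite /F nE block_bound.
have mg : (mean W (EFin \o g) <= (n%:R * l + n%:R * e')%:E)%E.
  rewrite mean_prod//; last by move=> z; rewrite lee_fin addr_ge0.
  rewrite (@eq_mean _ _ _ _ _ (fun s => (\sum_(x <- s) f N x)%:E + (expected r)%:E)%E)//; last first.
    move=> s _; rewrite -[X in (X + _)%E](mean_cst (pp_ r)) ?lee_fin// -expectedE.
    by rewrite -meanD// => y; rewrite lee_fin.
  rewrite meanD//; last by move=> _; rewrite lee_fin expected_ge0.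
  rewrite (mean_iid_sum _ _ _ (expectedE N))// mean_cst ?lee_fin ?expected_ge0//; last exact: iid_prob.
  rewrite -mulr_natl.
  have : k%:R * expected N <= k%:R * (N%:R * (l + e' / 2)) by exact: ler_wpM2l.
  have kN : k%:R * N%:R <= n%:R :> R by rewrite -natrM ler_nat nE leq_addr.
  have : k%:R * N%:R * (l + e' / 2) <= n%:R * (l + e' / 2).
    by rewrite ler_wpM2r// addr_ge0// divr_ge0// ltW.
  have : C <= n%:R * (e' / 2) by move: nC; rewrite ler_pdivrMr//; lra.
  lra.
have mF : ((n%:R * l)%:E <= mean W (EFin \o F))%E.
  rewrite -(transfer (EFin \o f n)); last by move=> x; rewrite lee_fin.
  by rewrite expectedE lee_fin; exact: growth_rate_le expected_ge0 _.
have mlow : (mean W (ind [set z | g z < n%:R * l - n%:R * e']%R) <= d%:E)%E.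
  apply: le_trans (_ : (theta ^+ k)%:E <= _)%E; last by rewrite lee_fin ltW.
  apply: le_trans (chern k).
  rewrite mean_prod//; last by move=> z; exact: ind_ge0.
  apply: le_mean => // s _; rewrite -[leRHS](mean_cst (pp_ r)) ?ind_ge0//.
  apply: le_mean => // y _; apply: ind_le; rewrite /= /g /= => gl.
  have fr := f0 r y; have ss := sum0 s.
  have rn : n%:R <= (k%:R + 1) * N%:R :> R.
    by rewrite natr1 -natrM ler_nat nE mulSn addnC leq_add2r ltnW.
  have kl' : l <= k%:R * (e' / 2).
    by move: kl; rewrite ler_pdivrMr//; lra.
  have : N%:R * l <= N%:R * (k%:R * (e' / 2)) by rewrite ler_wpM2l// ltW.
  (* If l < e', the threshold is negative while [g] is nonnegative, so the event is empty. *)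
  have [le'|le'] := leP 0 (l - e').
    have : n%:R * (l - e') <= (k%:R + 1) * N%:R * (l - e') by rewrite ler_wpM2r.
    have : 0 <= N%:R * e' by rewrite mulr_ge0// ltW.
    lra.
  have : n%:R * (l - e') <= 0 by rewrite mulr_ge0_le0// ltW.
  lra.
have f0' z : 0 <= F z by exact: f0.
have g0' z : 0 <= g z by rewrite addr_ge0.
have [] := @concentration _ _ W F g (n%:R * l) (n%:R * e') d (n%:R * e) Wp f0' Fg g0'
   (mulr_ge0 (ltW n0') l0) (mulr_ge0 (ltW n0') (ltW e'0)) (mulr_gt0 n0' e0) _ mg mF mlow.
  by rewrite -mulrA ler_pM2l.
rewrite !transfer => [up low| |]; [|by move=> x; exact: ind_ge0..].
split.
- apply: (@le_trans _ _ (((2 * (n%:R * e') + n%:R * l * d) / (n%:R * e))%:E)).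
    apply: le_trans up; apply: le_mean => // z _; apply: ind_le => /=.
    by rewrite mulrDr.
  rewrite lee_fin ler_pdivrMr ?mulr_gt0//.
  have -> : 2 * (n%:R * e') + n%:R * l * d = n%:R * (2 * e' + l * d) by ring.
  have -> : e * (n%:R * e) = n%:R * e ^+ 2 by ring.
  rewrite ler_pM2l//; lra.
- apply: (@le_trans _ _ ((2 * (n%:R * e') / (n%:R * e) + d)%:E)).
    apply: le_trans low; apply: le_mean => // z _; apply: ind_le => /=.
    by rewrite mulrBr.
  rewrite lee_fin.
  have : 2 * (n%:R * e') / (n%:R * e) <= e / 2.
    rewrite ler_pdivrMr ?mulr_gt0//.
    have -> : 2 * (n%:R * e') = n%:R * (2 * e') by ring.
    have -> : e / 2 * (n%:R * e) = n%:R * (e ^+ 2 / 2) by ring.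
    rewrite ler_pM2l//; lra.
  lra.
Unshelve. all: by end_near. Qed.

End Subadditive.

(** * Word norms and growth *)

Section WordNorm.
Context {G : groupType} (S : seq G) (genS : generating S).

Lemma word_of_length_ex g : exists n, word_of_length S g n.
Proof.
have : generated_subgroup [set` S] g by rewrite genS.
by move=> [s ws gs]; exists (size s), s.
Qed.

Lemma word_normP g : word_of_length S g (word_norm S g).
Proof.
rewrite /word_norm; case: pselect => [h|[]].
  by case: ex_minnP => m /asboolP.
by have [n gn] := word_of_length_ex g; exists n; apply/asboolP.
Qed.

Lemma word_norm_le g n : word_of_length S g n -> (word_norm S g <= n)%N.
Proof.
move=> gn; rewrite /word_norm; case: pselect => [h|//].
by case: ex_minnP => m _; apply; apply/asboolP.
Qed.

Lemma word_norm1 : word_norm S 1%g = 0%N.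
Proof.
apply/eqP; rewrite -leqn0; apply: word_norm_le.
by exists [::]; split => //; rewrite big_nil.
Qed.

Lemma word_normM g h : (word_norm S (g * h)%g <= word_norm S g + word_norm S h)%N.
Proof.
have [s [ws <- {1}->]] := word_normP g; have [t [wt <- {1}->]] := word_normP h.
apply: word_norm_le; exists (s ++ t); split; last 2 first.
- by rewrite size_cat.
- by rewrite big_cat.
by move=> x; rewrite mem_cat => /orP[/ws|/wt].
Qed.

Let word_normV_le g : (word_norm S g^-1%g <= word_norm S g)%N.
Proof.
have [s [ws <- {1}->]] := word_normP g.
apply: word_norm_le; exists [seq x^-1%g | x <- rev s]; split.
- move=> _ /mapP[x xs ->]; rewrite invgK.
  by rewrite mem_rev in xs; have [h|h] := ws x xs; [right|left].
- by rewrite size_map size_rev.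
- by rewrite big_map prodgV revK.
Qed.

Lemma word_normV g : word_norm S g^-1%g = word_norm S g.
Proof.
by apply/eqP; rewrite eqn_leq word_normV_le /= -{1}[g]invgK word_normV_le.
Qed.

Lemma word_distC x y : word_dist S x y = word_dist S y x.
Proof. by rewrite /word_dist -word_normV invgM invgK. Qed.

Lemma word_dist1 x : word_dist S x 1%g = word_norm S x.
Proof. by rewrite /word_dist mulg1 word_normV. Qed.

Lemma word_norm_prod (s : seq G) C : (forall x, x \in s -> (word_norm S x <= C)%N) ->
  (word_norm S (\prod_(x <- s) x)%g <= C * size s)%N.
Proof.
elim: s => [|x s IH] sC; first by rewrite big_nil word_norm1.
rewrite big_cons (leq_trans (word_normM _ _))// mulnS leq_add ?sC ?mem_head//.
by apply: IH => y ys; rewrite sC// inE ys orbT.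
Qed.

Lemma generating_countable : countable [set: G].
Proof.
have -> : [set: G] = range (fun s : seq (nat * bool) =>
    word_eval (fun i => nth 1%g S i) s).
  apply/seteqP; split=> // g _.
  have [s [ws _ ->]] := word_normP g.
  elim: s ws => [|x s IH] ws; first by exists [::] => //; rewrite /word_eval !big_nil.
  have [|t _ tE] := IH; first by move=> y ys; apply: ws; rewrite inE ys orbT.
  have [xS|xS] := ws x (mem_head _ _).
    exists ((index x S, true) :: t) => //.
    by rewrite /word_eval !big_cons /= nth_index// -tE.
  exists ((index x^-1%g S, false) :: t) => //.
  by rewrite /word_eval !big_cons /= nth_index// invgK -tE.
exact: card_le_trans (card_image_le _ _) (countableP _).
Qed.

End WordNorm.

Lemma word_norm_comparison (G : groupType) (S S' : seq G) :
  generating S -> generating S' ->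
  exists C, forall g, (word_norm S g <= C * word_norm S' g)%N.
Proof.
move=> gS gS'; exists (\sum_(x <- S') word_norm S x)%N => g.
have [s [ws <- {1}->]] := word_normP gS' g.
apply: word_norm_prod => // x xs.
have bound y : y \in S' -> (word_norm S y <= \sum_(x <- S') word_norm S x)%N.
  by move=> yS'; rewrite (big_rem y)//= leq_addr.
by have [/bound//|/bound] := ws x xs; rewrite word_normV.
Qed.

Section Growth.
Context {R : realType} {G : groupType} (S : seq G) (genS : generating S).

(** The letter [1%g] keeps the list nonempty when [S] is empty. *)
Let letters := (1%g :: S ++ [seq x^-1%g | x <- S]).
Let card := (size letters)%:R : R.
Let unif (x : G) : R := (count_mem x letters)%:R / card.

Let card0 : 0 < card. Proof. by rewrite ltr0n. Qed.

Let unif_prob : is_probability unif.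
Proof.
split; first by move=> x; rewrite divr_ge0// ltW.
transitivity (\esum_(x in [set: G])
    ((card^-1)%:E * \sum_(s <- letters) ((x == s)%:R)%:E))%E.
  apply: eq_esum => x _; rewrite sumEFin -EFinM mulrC; congr (_ * _)%:E.
  rewrite -sum1_count natr_sum big_mkcond; apply: eq_bigr => s _.
  by rewrite [x == s]eq_sym /=; case: (s == x).
rewrite esumZl ?lee_fin ?invr_ge0 ?(ltW card0)//; last first.
  by move=> x; apply: sume_ge0 => s _; rewrite lee_fin ler0n.
rewrite esum_sum; last by move=> *; rewrite lee_fin ler0n.
rewrite (eq_bigr (fun=> 1%E)) => [|s _]; last first.
  rewrite -[RHS](@mean_dirac R G s (fun=> 1%E))//; apply: eq_esum => x _.
  by rewrite mule1.
by rewrite sumEFin -EFinM big_const_seq count_predT iter_addr_0 mulVf// gt_eqF.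
Qed.

Let unif_ge s : s \in letters -> card^-1 <= unif s.
Proof.
move=> sl; rewrite /unif ler_pdivlMr// mulVf ?gt_eqF// ler1n.
by rewrite -has_count has_pred1.
Qed.

Let power_ge x : card^-1 ^+ word_norm S x <= convolution_power unif (word_norm S x) x.
Proof.
have [s [ws <- ->]] := word_normP genS x.
have ci : 0 <= card^-1 by rewrite invr_ge0 ltW.
elim: s ws => [|y s IH] ws /=; first by rewrite expr0 big_nil eqxx.
have p1 z : convolution_power unif 1 z = unif z.
  apply: EFin_inj; have := convolution_power1 unif_prob (ind_ge0 [set z]).
  rewrite !mean_ind !esum_set1 ?lee_fin// ?(prob_ge0 unif_prob)//.
  exact: convolution_power_ge0.
have := convolution_powerM unif_prob 1 (size s) y (\prod_(z <- s) z)%g.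
rewrite p1 add1n big_cons; apply: le_trans; rewrite exprS ler_pM ?exprn_ge0//.
  apply: unif_ge; rewrite inE mem_cat; apply/orP; right; apply/orP.
  have [yS|yS] := ws y (mem_head _ _); first by left.
  by right; apply/mapP; exists y^-1%g; rewrite ?invgK.
by apply: IH => z zs; apply: ws; rewrite inE zs orbT.
Qed.

(* The n-step uniform walk gives mass at least |letters|^-n to each element of
   norm n, so that the spheres grow at most exponentially. *)
Lemma growth_summable : exists2 c : R, 0 < c &
  (\esum_(x in [set: G]) (expR (- (c * (word_norm S x)%:R)))%:E < +oo)%E.
Proof.
have c1 : 1 <= card by rewrite ler1n.
(* The factor 2 pays for summing over all times: an element of norm n gets weight 2^-n card^-n, at
   most twice its mass under the average of the n-step laws with weights 2^-(n+1). *)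
exists (ln (2 * card)); first by rewrite ln_gt0//; lra.
have U0 n x : (0 <= (1 / (2 ^ n.+1)%:R * convolution_power unif n x)%:E)%E.
  by rewrite lee_fin mulr_ge0// convolution_power_ge0.
apply: (@le_lt_trans _ _ (\esum_(x in [set: G]) ((2 : R)%:E *
    \esum_(n in [set: nat]) (1 / (2 ^ n.+1)%:R * convolution_power unif n x)%:E)))%E.
  apply: le_esum => x _.
  have hx := @le_esum1 _ _ setT (fun n =>
    (1 / (2 ^ n.+1)%:R * convolution_power unif n x)%:E) (word_norm S x) (U0^~ x) I.
  have two : (0 <= (2 : R)%:E)%E by rewrite lee_fin.
  apply: le_trans (lee_wpmul2l two hx) => {hx}.
  rewrite -EFinM lee_fin; set n := word_norm S x.
  have -> : expR (- (ln (2 * card) * n%:R)) = 2^-1 ^+ n * card^-1 ^+ n.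
    rewrite -mulNr -lnV ?posrE ?mulr_gt0// mulr_natr -lnXn ?invr_gt0 ?mulr_gt0//.
    by rewrite lnK ?posrE ?exprn_gt0 ?invr_gt0 ?mulr_gt0// invfM exprMn.
  have -> y : 2 * (1 / (2 ^ n.+1)%:R * y) = 2^-1 ^+ n * y :> R.
    by rewrite natrX exprS invfM mul1r !mulrA divff ?pnatr_eq0// mul1r exprVn.
  by rewrite ler_wpM2l ?power_ge// exprn_ge0// invr_ge0.
rewrite esumZl//; last by move=> x; apply: esum_ge0.
rewrite esum_exchange//.
rewrite (eq_esum (b := fun n => (1 / (2 ^ n.+1)%:R)%:E)) => [|n _]; last first.
  have [h0 h1] := convolution_power_prob unif_prob n.
  rewrite -[RHS]mule1 -h1 -esumZl ?lee_fin//.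
rewrite -nneseries_esumT// (le_lt_trans (lee_wpmul2l _ (epsilon_trick0 xpredT _)))//.
by rewrite -EFinM ltry.
Qed.

End Growth.

(** * Entropy and total variation *)

Section Noise.
Context {R : realType} (T : choiceType) (mu : T -> R) (rho : R)
  (mup : is_probability mu) (rho01 : 0 <= rho <= 1).
Local Open Scope ereal_scope.

Let rho0 : (0 <= rho)%R. Proof. by case/andP: rho01. Qed.
Let rho1 : (0 <= 1 - rho)%R. Proof. by rewrite subr_ge0; case/andP: rho01. Qed.
Let mu0 := prob_ge0 mup.

Lemma mean_noise F : (forall z, 0 <= F z) -> mean (noise rho mu) F =
  rho%:E * mean mu (fun x => mean mu (fun y => F (x, y))) +
  (1 - rho)%:E * mean mu (fun x => F (x, x)).
Proof.
move=> F0; rewrite -mean_prod//.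
have <- : mean (diagonal_mass mu) F = mean mu (fun x => F (x, x)).
  transitivity (\esum_(z in range (fun x : T => (x, x)))
      ((diagonal_mass mu z)%:E * F z)).
    rewrite [RHS]esum_mkcond; apply: eq_esum => -[x y] _; rewrite /diagonal_mass /=.
    case: eqVneq => [->|xy]; first by rewrite mem_set//; exists y.
    by rewrite mul0e; case: ifP.
  rewrite esum_image; last by move=> x y _ _ [].
  by apply: eq_esum => x _; rewrite /diagonal_mass eqxx.
have dm0 z : (0 <= diagonal_mass mu z)%R by rewrite /diagonal_mass; case: ifP.
have p0 z : (0 <= prod_weight mu mu z)%R by exact: mulr_ge0.
rewrite /mean -!esumZl ?lee_fin//; try by move=> z; rewrite mule_ge0// lee_fin.
rewrite -esumD; try by move=> z _; rewrite !mule_ge0// lee_fin.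
apply: eq_esum => z _; rewrite /noise EFinD ge0_muleDl ?lee_fin ?mulr_ge0//.
by rewrite !EFinM !muleA.
Qed.

Let convex m : 0 <= m -> rho%:E * m + (1 - rho)%:E * m = m.
Proof.
move=> m0; rewrite -ge0_muleDl ?lee_fin// -EFinD addrC subrK.
by rewrite mul1e.
Qed.

Lemma mean_noise_fst F : (forall x, 0 <= F x) ->
  mean (noise rho mu) (F \o fst) = mean mu F.
Proof.
move=> F0; rewrite mean_noise//=.
have -> : mean mu (fun x => mean mu (fun=> F x)) = mean mu F.
  by apply: eq_mean => // x _; exact: mean_cst.
by rewrite convex// mean_ge0.
Qed.

Lemma mean_noise_snd F : (forall x, 0 <= F x) ->
  mean (noise rho mu) (F \o snd) = mean mu F.
Proof.
move=> F0; rewrite mean_noise//=.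
by rewrite mean_cst// ?convex// mean_ge0.
Qed.

Lemma noise_ge0 z : (0 <= noise rho mu z)%R.
Proof.
rewrite /noise addr_ge0// ?mulr_ge0//.
by rewrite /diagonal_mass; case: ifP.
Qed.

Lemma noise_prob : is_probability (noise rho mu).
Proof.
apply: is_probabilityE; first exact: noise_ge0.
by rewrite (mean_noise_fst (F := fun=> 1))// mean_cst.
Qed.

End Noise.

Section Projection.
Context {R : realType} {G H : groupType} (phi : G -> H) (p : G -> R) (q : H -> R)
  (pp : is_probability p) (qp : is_probability q)
  (phiM : {morph phi : x y / (x * y)%g}) (phi1 : phi 1%g = 1%g)
  (phi_mean : forall F, (forall x, (0 <= F x)%E) -> mean p (F \o phi) = mean q F).

(** Applied to the two projections of the product group: each coordinate of the walk is a walk of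
    law [mu], so both have the same drift for every [rho]. *)
Lemma mean_power_morph n F : (forall x, (0 <= F x)%E) ->
  mean (convolution_power p n) (F \o phi) = mean (convolution_power q n) F.
Proof.
elim: n F => [|n IH] F F0; first by rewrite /= !mean_dirac//= phi1.
have Fphi0 x : (0 <= (F \o phi) x)%E by exact: F0.
rewrite /= !mean_convolution//; try exact: convolution_power_prob.
rewrite -IH; last by move=> x; apply: mean_ge0 => //; exact: prob_ge0.
apply: eq_mean => [|x _]; first exact: convolution_power_ge0.
rewrite /= -phi_mean//; apply: eq_mean => [|y _]; first exact: prob_ge0.
by rewrite /= phiM.
Qed.

End Projection.

Section Entropy.
Context {R : realType} {G : groupType} (p : G -> R) (pp : is_probability p).
Local Notation p_ := (convolution_power p).

Definition self_information (n : nat) (x : G) : R := - ln (p_ n x).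

Definition entropy_rate : R := growth_rate (expected p self_information).

Let p0 n x : 0 <= p_ n x. Proof. exact: convolution_power_ge0. Qed.
Let pp_ n : is_probability (p_ n). Proof. exact: convolution_power_prob. Qed.

Lemma self_information_ge0 n x : 0 <= self_information n x.
Proof. by rewrite oppr_ge0 ln_le0// prob_le1. Qed.

Lemma self_information_sub n m x y : p_ n x != 0 -> p_ m y != 0 ->
  self_information (n + m) (x * y)%g <= self_information n x + self_information m y.
Proof.
move=> px py; have px' : 0 < p_ n x by rewrite lt_neqAle eq_sym px p0.
have py' : 0 < p_ m y by rewrite lt_neqAle eq_sym py p0.
have pxy := mulr_gt0 px' py'.
rewrite /self_information -opprD lerN2 -lnM ?posrE//.
rewrite ler_ln ?posrE ?convolution_powerM//.
exact: lt_le_trans pxy (convolution_powerM pp n m x y).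
Qed.

Lemma entropyE n : entropy (p_ n) = mean (p_ n) (EFin \o self_information n).
Proof. by apply: eq_esum => x _; rewrite -EFinM mulrN. Qed.

Context (entropy_fin : (mean (p_ 1) (EFin \o self_information 1) < +oo)%E).

Lemma asymptotic_entropyE : asymptotic_entropy p = (entropy_rate)%:E.
Proof.
rewrite /asymptotic_entropy.
have -> : (fun n => (n%:R^-1)%:E * entropy (p_ n))%E =
    (fun n => (expected p self_information n / n%:R)%:E).
  apply/funext => n; rewrite entropyE expectedE// -?EFinM 1?mulrC//.
  - exact: self_information_ge0.
  - exact: self_information_sub.
apply/cvg_lim => //; apply: cvg_EFin; first by apply: nearW.
apply: growth_rate_cvg.
- by apply: expected_ge0 => //; exact: self_information_ge0.
- apply: expected_sub => //; first exact: self_information_ge0.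
  exact: self_information_sub.
Qed.

Lemma entropy_concentration e : 0 < e -> \forall n \near \oo,
  (mean (p_ n) (ind [set x | n%:R * (entropy_rate + e) < self_information n x]%R)
     <= e%:E)%E /\
  (mean (p_ n) (ind [set x | self_information n x < n%:R * (entropy_rate - e)]%R)
     <= e%:E)%E.
Proof.
apply: subadditive_concentration => //.
- exact: self_information_ge0.
- exact: self_information_sub.
Qed.

(** Points of mass at least exp (- b). Nonvanishing is required separately because ln 0 = 0 would
    let in all points of mass zero when b >= 0. *)
Definition heavy_set n (b : R) : set G :=
  [set x | p_ n x != 0 /\ self_information n x <= b].

(** Each point weighs at least exp (- b) and the total mass is 1. Cardinals are written as sums of
    ones, so finiteness need not be known beforehand. *)
Lemma card_heavy_set n b : (\esum_(x in heavy_set n b) 1 <= (expR b)%:E)%E.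
Proof.
apply: (@le_trans _ _ (\esum_(x in [set: G]) ((expR b)%:E * (p_ n x)%:E)))%E.
  rewrite [leLHS]esum_mkcond; apply: le_esum => x _; case: ifPn; last first.
    by rewrite -EFinM lee_fin mulr_ge0// expR_ge0.
  rewrite inE /heavy_set /self_information /= => -[px xb].
  have px' : 0 < p_ n x by rewrite lt_neqAle eq_sym px p0.
  rewrite -EFinM lee_fin -[X in _ * X](lnK px') -expRD -[leLHS]expR0 ler_expR.
  by rewrite -lerBlDr sub0r.
rewrite esumZl ?lee_fin ?expR_ge0//; last by move=> x; rewrite lee_fin.
by case: (pp_ n) => _ ->; rewrite mule1.
Qed.

Lemma mean_heavy_set n b :
  (mean (p_ n) (ind (~` heavy_set n b)) <=
   mean (p_ n) (ind [set x | b < self_information n x]%R))%E.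
Proof.
apply: le_mean => // x px; apply: ind_le; rewrite /heavy_set /= => h.
by rewrite ltNge; apply/negP => xb; apply: h.
Qed.

(** A point outside the second event has mass at most exp (- b), so such points of [X] contribute at
    most exp (- b) times the cardinal of [X]. *)
Lemma mean_low_weight n b (X : set G) :
  (mean (p_ n) (ind X) <= (expR (- b))%:E * (\esum_(x in X) 1) +
   mean (p_ n) (ind [set x | self_information n x < b]%R))%E.
Proof.
set Y := [set x | _].
have w0 : (0 <= (expR (- b))%:E)%E by rewrite lee_fin expR_ge0.
have -> : (\esum_(x in X) 1 = \esum_(x in [set: G]) ind X x :> \bar R)%E.
  rewrite esum_mkcond; apply: eq_esum => x _; rewrite /ind indicE.
  by case: (x \in X).
rewrite -esumZl//; last by move=> x; exact: ind_ge0.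
rewrite -esumD; last 2 first.
- by move=> x _; rewrite mule_ge0 ?ind_ge0.
- by move=> x _; rewrite mule_ge0 ?ind_ge0 ?lee_fin.
apply: le_esum => x _.
case: (@indP R _ X x) => -[_ ->]; case: (@indP R _ Y x) => -[Yx ->];
  rewrite ?mule0 ?mule1 ?adde0 ?add0e ?lee_fin ?p0// -?EFinD ?lee_fin.
- by rewrite lerDr expR_ge0.
- have [->|px] := eqVneq (p_ n x) 0; first exact: expR_ge0.
  have px' : 0 < p_ n x by rewrite lt_neqAle eq_sym px p0.
  rewrite -[leLHS](lnK px') ler_expR.
  by move: Yx; rewrite /Y /= /self_information => /negP; rewrite -leNgt lerNr.
Qed.

End Entropy.

Section TotalVariation.
Context {R : realType}.

Lemma mass_bounds (T : choiceType) (p : T -> R) A : is_probability p ->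
  0 <= mass p A <= 1.
Proof.
move=> pp; rewrite -!lee_fin -mean_indE// mean_ind_le1// andbT.
by apply: mean_ge0 => [|x]; [exact: prob_ge0|exact: ind_ge0].
Qed.

Lemma tv_distance_le1 (T : choiceType) (p q : T -> R) :
  is_probability p -> is_probability q -> tv_distance p q <= 1.
Proof.
move=> pp qp; apply: ge_sup; first by exists `|mass p setT - mass q setT|, setT.
move=> _ [A _ <-]; have := mass_bounds A pp; have := mass_bounds A qp.
by rewrite ler_norml; lra.
Qed.

Lemma tv_distance_ge (T : choiceType) (p q : T -> R) A :
  is_probability p -> is_probability q -> mass p A - mass q A <= tv_distance p q.
Proof.
move=> pp qp; apply: le_trans (ler_norm _) _.
apply: ub_le_sup; last by exists A.
exists 1 => _ [B _ <-]; have := mass_bounds B pp; have := mass_bounds B qp.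
by rewrite ler_norml; lra.
Qed.

Lemma tv_distanceC (T : choiceType) (p q : T -> R) :
  tv_distance p q = tv_distance q p.
Proof.
by rewrite /tv_distance; congr sup; apply/seteqP; split => _ [A _ <-];
  exists A => //; rewrite distrC.
Qed.

Lemma mean_indC (T : choiceType) (p : T -> R) A : is_probability p ->
  (mean p (ind A) + mean p (ind (~` A)) = 1)%E.
Proof.
move=> pp; rewrite -meanD; [|exact: prob_ge0|by move=> x; exact: ind_ge0..].
rewrite -[RHS](mean_cst pp)//; apply: eq_mean => [|x _]; first exact: prob_ge0.
have [Ax|Ax] := pselect (A x).
  by rewrite ind1// ind0 ?adde0// => /(_ Ax).
by rewrite ind0// ind1 ?add0e.
Qed.

Context {G : groupType} (p q : G -> R) (pp : is_probability p) (qp : is_probability q)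
  (p_fin : (mean (convolution_power p 1) (EFin \o self_information p 1) < +oo)%E)
  (q_fin : (mean (convolution_power q 1) (EFin \o self_information q 1) < +oo)%E).

Lemma near_expRN (c e : R) : 0 < c -> 0 < e ->
  \forall n \near \oo, expR (- (n%:R * c)) <= e.
Proof.
move=> c0 e0; near=> n.
have n1 : (- ln e) / c <= n%:R by near: n; exact: nbhs_infty_ger.
rewrite -[leRHS](lnK e0) ler_expR.
by move: n1; rewrite ler_pdivrMr//; lra.
Unshelve. all: by end_near. Qed.

Lemma tv_distance_cvg1 : entropy_rate p < entropy_rate q ->
  tv_distance (convolution_power p n) (convolution_power q n) @[n --> \oo] --> (1 : R).
Proof.
set h := entropy_rate p; set h' := entropy_rate q => hh'.
apply/cvgrPdist_le => e e0.
(* Three errors [e1] arise, one for [p] and two for [q]. The other bound keeps half of the entropy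
   gap in the exponent h' - h - 2 e1. *)
pose e1 := Num.min (e / 3) ((h' - h) / 4).
have d0 : 0 < h' - h by rewrite subr_gt0.
have e10 : 0 < e1 by rewrite lt_min !divr_gt0.
have e1e : e1 <= e / 3 by rewrite ge_min lexx.
have e1h : e1 <= (h' - h) / 4 by rewrite ge_min lexx orbT.
have [N1 _ pN1] := entropy_concentration pp p_fin e10.
have [N2 _ qN2] := entropy_concentration qp q_fin e10.
near=> n.
have n1 : (N1 <= n)%N by near: n; exact: nbhs_infty_ge.
have n2 : (N2 <= n)%N by near: n; exact: nbhs_infty_ge.
have [pup _] := pN1 n n1; have [_ qlow] := qN2 n n2.
have pn := convolution_power_prob pp n; have qn := convolution_power_prob qp n.
rewrite ger0_norm ?subr_ge0 ?tv_distance_le1// lerBlDl -lerBlDr.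
pose A := heavy_set p n (n%:R * (h + e1)).
apply: le_trans (tv_distance_ge A pn qn).
have pA : 1 - e1 <= mass (convolution_power p n) A.
  rewrite lerBlDr -lee_fin EFinD -mean_indE// -(mean_indC A pn) leeD2l//.
  exact: le_trans (mean_heavy_set pp _ _) pup.
have qA : mass (convolution_power q n) A <= e1 + e1.
  rewrite -lee_fin EFinD -mean_indE//.
  apply: le_trans (mean_low_weight qp n (n%:R * (h' - e1)) A) _.
  apply: leeD => //.
  apply: le_trans (lee_wpmul2l _ (card_heavy_set pp _ _)) _.
    by rewrite lee_fin expR_ge0.
  rewrite -EFinM lee_fin -expRD.
  apply: (@le_trans _ _ (expR (- (n%:R * ((h' - h) / 2))))).
    rewrite ler_expR.
    have : n%:R * e1 <= n%:R * ((h' - h) / 4) by rewrite ler_wpM2l.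
    lra.
  by near: n; apply: near_expRN => //; rewrite divr_gt0.
lra.
Unshelve. all: by end_near. Qed.

End TotalVariation.

(** * Finite entropy from a finite first moment *)

Section FiniteEntropy.
Context {R : realType}.

Lemma convolution_power1E (G : groupType) (p : G -> R) : is_probability p ->
  convolution_power p 1 = p.
Proof.
move=> pp; apply/funext => z; apply: EFin_inj.
have := convolution_power1 pp (ind_ge0 [set z]).
rewrite !mean_ind !esum_set1 ?lee_fin// ?(prob_ge0 pp)//.
exact: convolution_power_ge0.
Qed.

(* Gibbs' inequality against the summable weight exp(- c N). *)
Lemma finite_entropy (T : choiceType) (p : T -> R) (N : T -> R) (c : R) :
  is_probability p -> (forall x, 0 <= N x) -> 0 < c ->
  (mean p (EFin \o N) < +oo)%E ->
  (\esum_(x in [set: T]) (expR (- (c * N x)))%:E < +oo)%E ->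
  (mean p (fun x => (- ln (p x))%:E) < +oo)%E.
Proof.
move=> pp N0 c0 mN sN; have p0 := prob_ge0 pp.
have w0 x : (0 <= (expR (- (c * N x)))%:E)%E by rewrite lee_fin expR_ge0.
have c0' : (0 <= c%:E)%E by rewrite lee_fin ltW.
have m0 x : (0 <= (c * N x)%:E)%E by rewrite lee_fin mulr_ge0// ltW.
apply: (@le_lt_trans _ _ (c%:E * mean p (EFin \o N) +
  (\esum_(x in [set: T]) (expR (- (c * N x)))%:E)))%E; last first.
  by apply: lte_add_pinfty => //; rewrite lte_mul_pinfty.
rewrite -meanZ//.
rewrite -esumD => [|x _|x _]; last 2 first.
- by rewrite mule_ge0 ?lee_fin// mulr_ge0 // ltW.
- exact: w0.
apply: le_esum => x _; rewrite /= -!EFinM -EFinD lee_fin.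
have [->|px] := eqVneq (p x) 0; first by rewrite !mul0r add0r expR_ge0.
have px' : 0 < p x by rewrite lt_neqAle eq_sym px p0.
(* Multiplied by [p x], this gives - p ln p <= c p N + exp (- c N) - p. *)
have := expR_ge1Dx (- (c * N x) - ln (p x)).
rewrite expRD [expR (- ln _)]expRN lnK// => h.
have := ler_wpM2l (ltW px') h; rewrite mulrCA divff// mulr1.
rewrite !mulrDr mulr1 !mulrN; lra.
Qed.

End FiniteEntropy.

Section NoiseEntropy.
Context {R : realType} {G : groupType} (S : seq G) (genS : generating S)
  (mu : G -> R) (mup : is_probability mu).
Local Open Scope ereal_scope.

(** The moment may be given for another generating set; the two norms are comparable. *)
Lemma moment_word_norm : finite_first_moment mu ->
  mean mu (fun x => (word_norm S x)%:R%:E) < +oo.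
Proof.
move=> [S' genS' momS'].
have [C SC] := word_norm_comparison genS genS'.
have mu0 := prob_ge0 mup.
apply: (@le_lt_trans _ _ (C%:R%:E * \esum_(x in [set: G])
    ((word_norm S' x)%:R * mu x)%:E)); last by rewrite lte_mul_pinfty.
rewrite -esumZl//; last by move=> x; rewrite lee_fin mulr_ge0.
apply: le_esum => x _; rewrite -!EFinM lee_fin mulrA mulrC.
by rewrite ler_wpM2r// -natrM ler_nat.
Qed.

Definition pair_norm (z : G * G) : R :=
  ((word_norm S z.1)%:R + (word_norm S z.2)%:R)%R.

(** The weight exp (- c (|x| + |y|)) factors, so the series over pairs is the square of the series
    over [G]. *)
Lemma pair_growth_summable c :
  \esum_(x in [set: G]) (expR (- (c * (word_norm S x)%:R)))%:E < +oo ->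
  \esum_(z in [set: G * G]) (expR (- (c * pair_norm z)))%:E < +oo.
Proof.
set K := \esum_(x in _) _ => K1.
have w0 (x : G) : 0 <= (expR (- (c * (word_norm S x)%:R)))%:E :> \bar R.
  by rewrite lee_fin expR_ge0.
have K0 : 0 <= K by apply: esum_ge0.
have -> : \esum_(z in [set: G * G]) (expR (- (c * pair_norm z)))%:E = K * K.
  transitivity (\esum_(x in [set: G]) \esum_(y in [set: G])
    ((expR (- (c * (word_norm S x)%:R)))%:E * (expR (- (c * (word_norm S y)%:R)))%:E));
    last first.
    by rewrite -[RHS]esumZl//; apply: eq_esum => x _; rewrite esumZl// muleC.
  rewrite esum_esum; last by move=> x y _ _; rewrite mule_ge0.
  have -> : [set: G] `*`` (fun=> [set: G]) = setT by apply/seteqP; split.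
  apply: eq_esum => -[x y] _ /=; rewrite -EFinM -expRD.
  by congr (expR _)%:E; rewrite /pair_norm /=; ring.
by rewrite lte_mul_pinfty// ge0_fin_numE.
Qed.

Lemma noise_finite_entropy (rho : R) : (0 <= rho <= 1)%R ->
  finite_first_moment mu ->
  mean (convolution_power (noise rho mu) 1)
    (EFin \o self_information (noise rho mu) 1) < +oo.
Proof.
move=> rho01 mom; have np := noise_prob mup rho01.
have [c c0 sc] := growth_summable (R := R) genS.
rewrite convolution_power1E//.
apply: (le_lt_trans _ (@finite_entropy _ _ _ pair_norm c np _ c0 _ _)).
- by rewrite /comp /self_information convolution_power1E.
- by move=> z; rewrite addr_ge0.
- have mm := moment_word_norm mom.
  have n0 := noise_ge0 mup rho01.
  rewrite [X in X < _](_ : _ = mean (noise rho mu) (fun z =>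
     ((fun x => (word_norm S x)%:R%:E) \o fst) z +
     ((fun x => (word_norm S x)%:R%:E) \o snd) z)); last first.
    by apply: eq_mean.
  rewrite meanD//; try by move=> x; rewrite lee_fin.
  rewrite mean_noise_fst// ?mean_noise_snd//; try by move=> x; rewrite lee_fin.
  exact: lte_add_pinfty.
- exact: pair_growth_summable.
Qed.

End NoiseEntropy.

Lemma near_nat2P (P : nat -> nat -> Prop) :
  (\forall i & j \near \oo, P i j) <->
  exists N, forall i j, (N <= i)%N -> (N <= j)%N -> P i j.
Proof.
split => [[[A B] [/= [N1 _ A1] [N2 _ B2]] AB]|[N NP]].
  exists (maxn N1 N2) => i j; rewrite !geq_max => /andP[i1 i2] /andP[j1 j2].
  by apply: (AB (i, j)); split; [exact: A1|exact: B2].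
exists ([set i | (N <= i)%N], [set i | (N <= i)%N]) => /=.
  by split; exists N.
by move=> [i j] /= [? ?]; exact: NP.
Qed.

(** * Shadows in the Gromov boundary *)

Section GromovProduct.
Context {R : realType} {G : groupType} (S : seq G) (genS : generating S).
Local Notation gp := (gromov_product R S 1%g).
Local Notation nrm x := ((word_norm S x)%:R : R).

Lemma gromov_productE x y : gp x y = (nrm x + nrm y - nrm (x^-1 * y)%g) / 2.
Proof. by rewrite /gromov_product !word_dist1. Qed.

Lemma gromov_productC x y : gp x y = gp y x.
Proof. by rewrite /gromov_product (word_distC genS x y) [X in X - _]addrC. Qed.

Lemma gromov_product_lel x y : gp x y <= nrm x.
Proof.
rewrite gromov_productE ler_pdivrMr//.
have : nrm y <= nrm x + nrm (x^-1 * y)%g.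
  by rewrite -natrD ler_nat -{1}[y](mulVKg x) word_normM.
lra.
Qed.

End GromovProduct.

Section Shadows.
Context {R : realType} {G : groupType} (S : seq G) (genS : generating S)
  (delta : R) (delta0 : 0 <= delta).
Local Notation gp := (gromov_product R S 1%g).
Context (hyp : forall x y z : G, Num.min (gp x z) (gp z y) - delta <= gp x y).
Implicit Types xi zeta : boundary R S.
Local Notation inl_ := (@in_group R G S).
Local Notation inr_ := (@in_boundary R G S).

Lemma hyp_le x y z (r : R) : r <= gp x z -> r <= gp z y -> r - delta <= gp x y.
Proof.
by move=> rx ry; apply: le_trans (hyp x y z); rewrite lerD2r le_min rx.
Qed.

Lemma hyp_le3 x y z t (r : R) : r <= gp x y -> r <= gp y z -> r <= gp z t ->
  r - 2 * delta <= gp x t.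
Proof.
move=> xy yz zt; have -> : r - 2 * delta = (r - delta) - delta by ring.
apply: (@hyp_le _ _ z); first exact: hyp_le xy yz.
by apply: le_trans zt; rewrite lerBlDr lerDl.
Qed.

(** Both sequences are asymptotic to the one defining the class; hyperbolicity through one of its
    terms costs [delta], which the thresholds include in advance. *)
Lemma sequences_asymptotic xi x x' : sequences_of xi x -> sequences_of xi x' ->
  forall M, exists N, forall i j, (N <= i)%N -> (N <= j)%N -> M <= gp (x i) (x' j).
Proof.
case: xi => s [x0 cx0 sE] /=; rewrite sE => -[_ ax] [_ ax'] M.
have /near_nat2P[N1 h1] := ax (M + delta).
have /near_nat2P[N2 h2] := ax' (M + delta).
exists (maxn N1 N2) => i j; rewrite !geq_max => /andP[i1 i2] /andP[j1 j2].
rewrite -[leLHS](addrK delta); apply: (@hyp_le _ _ (x0 (maxn N1 N2))).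
- by rewrite gromov_productC// h1 ?leq_maxl.
- by rewrite h2 ?leq_maxr.
Qed.

Lemma sequences_nonempty xi : exists x, sequences_of xi x.
Proof. by case: xi => s [x0 cx0 sE]; exists x0; rewrite /= sE; split. Qed.

Lemma in_shadowP xi r a : shadow xi r (inl_ a) <->
  exists2 x, sequences_of xi x &
    exists N, forall i, (N <= i)%N -> r <= gp (x i) a.
Proof.
split => [[x [y [xx ya /near_nat2P[N NP]]]]|[x xx [N NP]]].
  move: ya NP; rewrite /representatives /= => -> NP.
  by exists x => //; exists N => i Ni; exact: (NP i N).
exists x, (fun=> a); split => //.
by apply/near_nat2P; exists N => i _ Ni _; exact: NP.
Qed.

Lemma shadow_refl xi r : shadow xi r (inr_ xi).
Proof.
have [x xx] := sequences_nonempty xi.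
exists x, x; split => //; apply/near_nat2P.
have [N NP] := sequences_asymptotic xx xx r; by exists N.
Qed.

(** The two shadows may use different representatives of [zeta], so hyperbolicity is applied along a
    chain of four points, at the cost of [2 * delta]. *)
Lemma shadow_trans xi zeta r p : shadow xi r (inr_ zeta) -> shadow zeta r p ->
  shadow xi (r - 2 * delta) p.
Proof.
move=> [x [y [xx yz /near_nat2P[N1 h1]]]] [y' [z [yz' zp /near_nat2P[N2 h2]]]].
exists x, z; split => //; apply/near_nat2P.
have [N3 h3] := sequences_asymptotic yz yz' r.
pose N := maxn N1 (maxn N2 N3).
have [n1 n2 n3] : [/\ (N1 <= N)%N, (N2 <= N)%N & (N3 <= N)%N].
  by rewrite /N !leq_max !leqnn !orbT.
exists N => i j Ni Nj; apply: (@hyp_le3 _ (y N) (y' N)).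
- by apply: h1 => //; exact: leq_trans Ni.
- exact: h3.
- by apply: h2 => //; exact: leq_trans Nj.
Qed.

Lemma shadow_sym xi zeta r : shadow xi r (inr_ zeta) -> shadow zeta r (inr_ xi).
Proof.
move=> [x [y [xx yz /near_nat2P[N NP]]]]; exists y, x; split => //.
by apply/near_nat2P; exists N => i j Ni Nj; rewrite gromov_productC// NP.
Qed.

Lemma shadow_gromov_product xi r a b :
  shadow xi r (inl_ a) -> shadow xi r (inl_ b) -> r - 2 * delta <= gp a b.
Proof.
move=> /in_shadowP[x xx [N1 h1]] /in_shadowP[x' xx' [N2 h2]].
have [N3 h3] := sequences_asymptotic xx xx' r.
pose N := maxn N1 (maxn N2 N3).
have [n1 n2 n3] : [/\ (N1 <= N)%N, (N2 <= N)%N & (N3 <= N)%N].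
  by rewrite /N !leq_max !leqnn !orbT.
apply: (@hyp_le3 _ (x N) (x' N)); [|exact: h3|exact: h2].
by rewrite gromov_productC// h1.
Qed.

Lemma shadow_near xi r a b : shadow xi r (inl_ b) -> r <= gp a b ->
  shadow xi (r - delta) (inl_ a).
Proof.
move=> /in_shadowP[x xx [N NP]] ab; apply/in_shadowP; exists x => //.
exists N => i Ni; apply: hyp_le (NP _ Ni) _.
by rewrite gromov_productC.
Qed.

(* Shadows need not be open; by hyperbolicity this smaller set is. *)
Definition open_shadow xi r : set (bordification R S) :=
  [set p | shadow xi r p /\
    forall zeta, p = inr_ zeta -> exists s, shadow zeta s `<=` shadow xi r].

Lemma open_shadow_open xi r : open (open_shadow xi r).
Proof.
move=> zeta [xz /(_ zeta erefl)[s zs]].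
(* The margin pays for one use of [shadow_trans]: a boundary point [p] of this smaller shadow has a
   whole shadow inside that of [zeta], hence inside that of [xi]. *)
exists (s + 2 * delta) => p zp; split.
  by apply: zs; apply: le_shadow zp; rewrite lerDl mulr_ge0.
move=> eta pE; exists (s + 2 * delta); rewrite pE in zp.
move=> q eq; apply: zs; rewrite -[s](addrK (2 * delta)).
exact: shadow_trans zp eq.
Qed.

Lemma open_shadow_center xi r : open_shadow xi r (inr_ xi).
Proof. by split; [exact: shadow_refl|move=> _ [<-]; exists r]. Qed.

Lemma shadow_nbhs xi r : nbhs (inr_ xi) (shadow xi r).
Proof.
apply: (filterS (P := open_shadow xi r)); first by move=> p [].
apply: open_nbhs_nbhs; split; first exact: open_shadow_open.
exact: open_shadow_center.
Qed.

Lemma cvg_shadow (w : nat -> G) xi r : inl_ (w n) @[n --> \oo] --> inr_ xi ->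
  \forall n \near \oo, shadow xi r (inl_ (w n)).
Proof. by move=> /(_ _ (shadow_nbhs xi r)). Qed.

(** The boundary points seen behind [a], thickened to an open set: it contains every [xi] with [a]
    in [shadow xi r], and each of its points has [a] in its shadow of parameter [r - 2 * delta]. *)
Definition dual_shadow a (r : R) : set (boundary R S) :=
  [set zeta | exists2 xi, shadow xi r (inl_ a) & open_shadow xi r (inr_ zeta)].

Lemma dual_shadow_open a r : open (dual_shadow a r).
Proof.
have -> : dual_shadow a r = \bigcup_(xi in [set xi | shadow xi r (inl_ a)])
    (inr_ @^-1` open_shadow xi r).
  by apply/seteqP; split => zeta [xi ? ?]; exists xi.
apply: bigcup_open => xi _.
apply: open_comp; last exact: open_shadow_open.
by move=> zeta _; exact: initial_continuous.
Qed.

Lemma sub_dual_shadow a r xi : shadow xi r (inl_ a) -> dual_shadow a r xi.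
Proof. by move=> ?; exists xi => //; exact: open_shadow_center. Qed.

Lemma dual_shadow_sub a r xi : dual_shadow a r xi ->
  shadow xi (r - 2 * delta) (inl_ a).
Proof. by move=> [zeta za [zx _]]; exact: shadow_trans (shadow_sym zx) za. Qed.

End Shadows.

(** * Sample paths *)

Section CountablePartition.
Context {R : realType} d (Omega : measurableType d) (P : probability Omega R)
  (G : choiceType) (cG : countable [set: G]) (Y : Omega -> G)
  (mY : forall A : set G, measurable (Y @^-1` A)).
Local Open Scope ereal_scope.

Lemma countable_partition (F : set Omega) : measurable F ->
  P F = \esum_(g in [set: G]) P (F `&` Y @^-1` [set g]).
Proof.
move=> mF; have /countable_injP[f /in2TT finj] := cG.
have {1}-> : F = \bigcup_n (F `&` (f \o Y) @^-1` [set n]).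
  apply/seteqP; split => [x Fx|x [n _ []]//]; by exists (f (Y x)).
have mFn n : measurable (F `&` (f \o Y) @^-1` [set n]).
  by apply: measurableI => //; exact: (mY (f @^-1` [set n])).
rewrite measure_bigcup//=; last first.
  by move=> i j _ _ [x [[_ /= <-] [_ /= <-]]].
rewrite nneseries_esum// set_mem_set.
transitivity (\esum_(n in range f) P (F `&` (f \o Y) @^-1` [set n])).
  rewrite [RHS]esum_mkcond; apply: eq_esum => n _; case: ifPn => // /negP nf.
  rewrite (_ : _ `&` _ = set0) ?measure0//; apply/seteqP; split => // x [_ /= fx].
  by apply: nf; rewrite inE; exists (Y x).
rewrite esum_image; last by move=> x y _ _; exact: finj.
apply: eq_esum => g _; congr (P _).
by apply/seteqP; split => x /= [Fx]; [move=> /finj <-|move=> <-].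
Qed.

End CountablePartition.

Section WalkLaw.
Context {R : realType} d (Omega : measurableType d) (P : probability Omega R)
  (G : groupType) (cG : countable [set: G]) (p : G -> R) (pp : is_probability p)
  (X : nat -> Omega -> G) (lawX : forall n, has_law P (X n) p)
  (indX : independent P X).
Local Open Scope ereal_scope.
Local Notation p_ := (convolution_power p).

Let mX n A : measurable (X n @^-1` A). Proof. by case: (lawX n A). Qed.

Definition segment n k omega : G := (\prod_(i < k) X (n + i)%N omega)%g.

Lemma segmentS n k omega :
  segment n k.+1 omega = (segment n k omega * X (n + k)%N omega)%g.
Proof. by rewrite /segment big_ord_recr. Qed.

Lemma segmentD k omega n : segment 0 (n + k) omega =
  (segment 0 n omega * segment n k omega)%g.
Proof.
by rewrite /segment big_split_ord.
Qed.

Lemma measurable_segment n k A : measurable (segment n k @^-1` A).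
Proof.
elim: k A => [|k IH] A.
  have [A1|A1] := pselect (A 1%g).
    rewrite (_ : _ @^-1` _ = setT)//; apply/seteqP; split => // x _.
    by rewrite /preimage /= /segment big_ord0.
  rewrite (_ : _ @^-1` _ = set0)//; apply/seteqP; split => // x.
  by rewrite /preimage /= /segment big_ord0.
have -> : segment n k.+1 @^-1` A = \bigcup_(g in [set: G])
    (segment n k @^-1` [set g] `&` X (n + k)%N @^-1` [set x | A (g * x)%g]).
  apply/seteqP; split => x /=; first by rewrite segmentS => Ax; exists (segment n k x).
  by move=> [g _ [/= <-]]; rewrite segmentS.
by apply: countable_bigcupT_measurable => // g; apply: measurableI.
Qed.

(** [E] has probability [c] and is independent of the increments from time [m] on. Testing finite
    cylinders suffices, and carrying [c] along lets inductions multiply probabilities. *)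
Definition independent_of_future (E : set Omega) (c : \bar R) (m : nat) : Prop :=
  measurable E /\ forall (J : seq nat) (B : nat -> set G), uniq J ->
    (forall j, j \in J -> (m <= j)%N) ->
    P (E `&` \bigcap_(j in [set` J]) (X j @^-1` B j)) =
      c * \prod_(j <- J) P (X j @^-1` B j).

Lemma independent_of_future0 : independent_of_future setT 1 0.
Proof. by split => // J B uJ _; rewrite setTI mul1e indX. Qed.

Lemma independent_of_futureP E c m : independent_of_future E c m -> P E = c.
Proof.
move=> [_ /(_ [::] (fun=> set0) isT)]; rewrite big_nil mule1 => <-//.
by rewrite (_ : [set` [::]] = set0) ?bigcap_set0 ?setIT//; apply/seteqP; split.
Qed.

Let bigcap_measurable (J : seq nat) (B : nat -> set G) :
  measurable (\bigcap_(j in [set` J]) (X j @^-1` B j)).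
Proof. by apply: fin_bigcap_measurable => [|j _]; [exact: finite_seq|exact: mX]. Qed.

Lemma independent_of_futureS E c m A : independent_of_future E c m ->
  independent_of_future (E `&` X m @^-1` A) (c * mean p (ind A)) m.+1.
Proof.
move=> [mE indE]; split; first exact: measurableI.
move=> J B uJ Jm.
(* The condition at time [m] joins the future ones, giving a cylinder over [m :: J] to which the
   hypothesis on [E] applies. *)
pose B' j := if j == m then A else B j.
have mJ : m \notin J by apply/negP => /Jm; rewrite ltnn.
have B'E j : j \in J -> B' j = B j.
  by move=> jJ; rewrite /B'; case: eqP => // jm; move: jJ mJ; rewrite jm => ->.
have := indE (m :: J) B'; rewrite /= mJ uJ => /(_ isT) h.
rewrite mean_ind; have [_ <-] := lawX m A.
transitivity (P (E `&` \bigcap_(j in [set` m :: J]) X j @^-1` B' j)).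
  congr (P _); rewrite -setIA; congr (_ `&` _); apply/seteqP; split => x.
    move=> [Am Bx] j /=; rewrite inE => /orP[/eqP ->|jJ]; first by rewrite /B' eqxx.
    by rewrite B'E//; exact: Bx.
  move=> Bx; split; first by have := Bx m; rewrite /= /B' eqxx; apply; rewrite mem_head.
  by move=> j jJ; rewrite -B'E//; apply: Bx; rewrite /= inE jJ orbT.
rewrite h; last by move=> j; rewrite inE => /orP[/eqP ->//|/Jm]; exact: ltnW.
rewrite big_cons muleA /B' eqxx; congr (_ * _).
by rewrite !big_seq; apply: eq_bigr => j /B'E; rewrite /B' => ->.
Qed.

(** Induction on [k]: split over the countably many values of the product of the first [k]
    increments, then apply [independent_of_futureS] to the next one. *)
Lemma independent_of_future_segment E c m k B : 0 <= c -> independent_of_future E c m ->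
  independent_of_future (E `&` segment m k @^-1` B) (c * mean (p_ k) (ind B)) (m + k).
Proof.
move=> c0 [mE indE]; have p0 := prob_ge0 pp.
have pk0 := convolution_power_ge0 pp.
elim: k B => [|k IH] B.
  rewrite addn0 mean_dirac; last by move=> x; exact: ind_ge0.
  have [B1|B1] := pselect (B 1%g).
    rewrite ind1// mule1 (_ : _ @^-1` _ = setT) ?setIT//.
    by apply/seteqP; split => // x _; rewrite /preimage /= /segment big_ord0.
  rewrite ind0// mule0 (_ : _ @^-1` _ = set0).
    split; first by rewrite setI0.
    by move=> J B' _ _; rewrite setI0 set0I measure0 mul0e.
  by apply/seteqP; split => // x; rewrite /preimage /= /segment big_ord0.
split; first by apply: measurableI => //; exact: measurable_segment.
move=> J B' uJ Jm; rewrite addnS in Jm.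
pose Q := \prod_(j <- J) P (X j @^-1` B' j).
have Q0 : 0 <= Q by rewrite /Q prode_ge0.
rewrite (@countable_partition _ _ _ _ _ cG (segment m k)); last 2 first.
- exact: measurable_segment.
- apply: measurableI => //; apply: measurableI => //; exact: measurable_segment.
transitivity (\esum_(g in [set: G])
    (c * mean (p_ k) (ind [set g]) * mean p (ind [set x | B (g * x)%g]) * Q)).
  apply: eq_esum => g _.
  have [_ <-//] := independent_of_futureS [set x | B (g * x)%g] (IH [set g]).
  congr (P _); apply/seteqP; split => x /=.
    by move=> [[[Ex]]]; rewrite segmentS => Bx BJ <-.
  by move=> [[[Ex gE] Bx] BJ]; rewrite segmentS gE.
have ig0 (A : set G) q : (forall x, (0 <= q x)%R) -> 0 <= mean q (@ind R _ A).
  by move=> q0; apply: mean_ge0 => // x; exact: ind_ge0.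
rewrite (eq_esum (b := fun g => (Q * c) * ((p_ k g)%:E * mean p (ind [set x | B (g * x)%g])))) => [|g _]; last first.
  rewrite (mean_ind (p_ k)) esum_set1 ?lee_fin//.
  by rewrite [LHS]muleC -!muleA.
rewrite esumZl ?mule_ge0// => [|g]; last by rewrite mule_ge0 ?lee_fin ?ig0.
rewrite /= mean_convolution//; last 2 first.
- exact: convolution_power_prob.
- by move=> x; exact: ind_ge0.
by rewrite -muleA muleC; congr (_ * _ * _).
Qed.

Lemma segment_law n A : P (segment 0 n @^-1` A) = mean (p_ n) (ind A).
Proof.
have := independent_of_future_segment n A (@lee01 R) independent_of_future0.
by rewrite setTI mul1e; exact: independent_of_futureP.
Qed.

Lemma segment_joint_law n k (D : set (G * G)) :
  P [set omega | D (segment 0 n omega, segment n k omega)] =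
  mean (p_ n) (fun x => mean (p_ k) (ind [set y | D (x, y)])).
Proof.
have pk0 := convolution_power_ge0 pp.
have mD : measurable [set omega | D (segment 0 n omega, segment n k omega)].
  have -> : [set omega | D (segment 0 n omega, segment n k omega)] =
      \bigcup_(g in [set: G]) (segment 0 n @^-1` [set g] `&`
        segment n k @^-1` [set y | D (g, y)]).
    apply/seteqP; split => x /= => [Dx|[g _ [/= <-]]//].
    by exists (segment 0 n x).
  apply: countable_bigcupT_measurable => // g.
  by apply: measurableI; exact: measurable_segment.
rewrite (@countable_partition _ _ _ _ _ cG (segment 0 n))//; last first.
  exact: measurable_segment.
apply: eq_esum => g _.
have := independent_of_future_segment n [set g] (@lee01 R) independent_of_future0; rewrite setTI mul1e add0n.
rewrite mean_ind esum_set1 ?lee_fin// => hg.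
have g0 : 0 <= (p_ n g)%:E by rewrite lee_fin.
have := independent_of_future_segment k [set y | D (g, y)] g0 hg => /independent_of_futureP <-.
congr (P _); apply/seteqP; split => x /=.
  by move=> [Dx gx]; rewrite -gx in Dx *.
by move=> [<-].
Qed.

End WalkLaw.

Section Tracking.
Context {R : realType} d (Omega : measurableType d) (P : probability Omega R)
  (G : groupType) (cG : countable [set: G]) (p : G -> R) (pp : is_probability p)
  (X : nat -> Omega -> G) (lawX : forall n, has_law P (X n) p)
  (indX : independent P X).
Context {H : groupType} (S : seq H) (genS : generating S) (phi : G -> H)
  (phiM : {morph phi : x y / (x * y)%g})
  (delta : R) (delta0 : 0 <= delta)
  (hyp : forall x y z : H, Num.min (gromov_product R S 1%g x z)
     (gromov_product R S 1%g z y) - delta <= gromov_product R S 1%g x y).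
Context (a : nat -> R) (a0 : forall n, 0 <= a n)
  (aE : forall n, mean (convolution_power p n)
     (fun x => (word_norm S (phi x))%:R%:E) = (a n)%:E).
Local Notation p_ := (convolution_power p).
Local Notation gp := (gromov_product R S 1%g).
Local Notation nrm x := ((word_norm S x)%:R : R).

Let l := growth_rate a.
Let w n := segment X 0 n.

(** The difference |w_n| - (w_n | w_(n+k)) is the Gromov product of 1 and w_(n+k) based at w_n: up
    to O(delta), the distance from w_n to a geodesic from 1 to w_(n+k). *)
Definition backtrack (e : R) (n k : nat) : set Omega :=
  [set omega | n%:R * e < nrm (phi (w n omega)) -
     gp (phi (w n omega)) (phi (w (n + k) omega))].

Let D (n : nat) (e : R) : set (G * G) :=
  [set z | n%:R * e < nrm (phi z.1) - gp (phi z.1) (phi (z.1 * z.2)%g)].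

Let backtrackE e n k : backtrack e n k =
  [set omega | D n e (w n omega, segment X n k omega)].
Proof.
by apply/seteqP; split => omega; rewrite /backtrack /D /= /w segmentD.
Qed.

Lemma measurable_backtrack e n k : measurable (backtrack e n k).
Proof.
rewrite backtrackE.
have -> : [set omega | D n e (w n omega, segment X n k omega)] =
    \bigcup_(g in [set: G]) (w n @^-1` [set g] `&`
      segment X n k @^-1` [set y | D n e (g, y)]).
  apply/seteqP; split => x /= => [Dx|[g _ [/= <-]]//].
  by exists (w n x).
apply: countable_bigcupT_measurable => // g.
by apply: measurableI; exact: (measurable_segment cG lawX).
Qed.

(* Markov: the mean of |w_n| - (w_n | w_(n+k)) is (a_n + a_k - a_(n+k)) / 2. *)
Lemma backtrack_le (e : R) n k : (0 < n)%N -> 0 < e ->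
  (P (backtrack e n k) <= ((a n + a k - a (n + k)%N) / (2 * (n%:R * e)))%:E)%E.
Proof.
move=> n0 e0; rewrite backtrackE (segment_joint_law cG pp lawX indX).
have pn0 := convolution_power_ge0 pp n; have pk0 := convolution_power_ge0 pp k.
have ne0 : 0 < n%:R * e :> R by rewrite mulr_gt0 ?ltr0n.
have pnp := convolution_power_prob pp n; have pkp := convolution_power_prob pp k.
set I := mean _ _.
pose W := prod_weight (p_ n) (p_ k).
have Wp : is_probability W by exact: prod_weight_prob.
have W0 := prob_ge0 Wp.
have IE : I = mean W (ind (D n e)) by rewrite mean_prod// => z; exact: ind_ge0.
have IfinE : I = (mass W (D n e))%:E by rewrite IE mean_indE.
have nn0 (x : H) : (0 <= (nrm x)%:E)%E by rewrite lee_fin.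
have h1 : mean W (fun z => (nrm (phi z.1))%:E) = (a n)%:E.
  rewrite mean_prod// -aE; apply: eq_mean => // x _; exact: (mean_cst pkp (nn0 (phi x))).
have h2 : mean W (fun z => (nrm (phi z.2))%:E) = (a k)%:E.
  by rewrite mean_prod//= aE mean_cst// lee_fin.
have h3 : mean W (fun z => (nrm (phi (z.1 * z.2)%g))%:E) = (a (n + k)%N)%:E.
  by rewrite mean_prod// -aE mean_convolution_powerD.
(* Pointwise, |x| + |y| - |x y| is twice the nonnegative quantity |x| - (x | x y). The term |x y| is
   moved to the left to avoid subtraction of means. *)
have : (mean W (fun z => (2 * (n%:R * e))%:E * ind (D n e) z +
     (nrm (phi (z.1 * z.2)%g))%:E) <=
   mean W (fun z => (nrm (phi z.1))%:E + (nrm (phi z.2))%:E))%E.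
  apply: le_mean => // z _.
  have := @gromov_product_lel R _ _ genS (phi z.1) (phi (z.1 * z.2)%g).
  have := @gromov_productE R _ _ genS (phi z.1) (phi (z.1 * z.2)%g).
  rewrite phiM mulKg; set g := gromov_product _ _ _ _ _ => gE gl.
  case: (@indP R _ (D n e) z) => -[Dz ->]; rewrite -?EFinM -!EFinD lee_fin.
    move: Dz; rewrite /D /= phiM -/g; lra.
  lra.
have c0 : (0 <= (2 * (n%:R * e))%:E)%E by rewrite lee_fin mulr_ge0// ltW.
rewrite !meanD//; last by move=> z; rewrite mule_ge0 ?ind_ge0.
rewrite meanZ//; last by move=> z; exact: ind_ge0.
rewrite h1 h2 h3 -IE IfinE -EFinM -!EFinD !lee_fin => h.
rewrite ler_pdivlMr; [lra|by rewrite mulr_gt0].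
Qed.

(* F is the event that w backtracks by more than n e at almost all times n + k
   along a sequence of k with a_(n+k) - a_k >= n l - 1. *)
Lemma tracking (e : R) n : (0 < n)%N -> 0 < e ->
  exists F : set Omega, [/\ measurable F,
    (P F <= ((a n - n%:R * l + 1) / (2 * (n%:R * e)))%:E)%E &
    forall omega xi, ~ F omega ->
      in_group R S (phi (w m omega)) @[m --> \oo] --> in_boundary xi ->
      shadow xi (nrm (phi (w n omega)) - n%:R * e - delta)
        (in_group R S (phi (w n omega)))].
Proof.
move=> n0 e0.
have /choice[k kP] : forall M, exists k, (M <= k)%N /\
    n%:R * l - 1 <= a (n + k)%N - a k.
  by move=> M; have [k ? ?] := growth_rate_increment a0 n M (@ltr01 R); exists k.
(* The union of the [F M] is the lower limit of the backtracking events, so it inherits their common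
   bound. Outside it there are arbitrarily late times without backtracking, when the walk is already
   in the shadow of its limit. *)
pose F M := \bigcap_(j in [set j | (M <= j)%N]) backtrack e n (k j).
have mF M : measurable (F M).
  by apply: bigcap_measurable => [|j _]; [exists M => /=|exact: measurable_backtrack].
exists (\bigcup_M F M); split.
- exact: bigcupT_measurable.
- have Fnd : nondecreasing_seq F.
    apply/nondecreasing_seqP => M; apply/subsetPset => omega FM j /= Mj.
    by apply: FM => /=; exact: ltnW.
  have cvgF := @nondecreasing_cvg_mu _ _ _ P _ mF (bigcupT_measurable _ mF) Fnd.
  rewrite -(cvg_lim _ cvgF)//; apply: lime_le; first by apply/cvg_ex; eexists; exact: cvgF.
  apply: nearW => M /=.
  have FM : F M `<=` backtrack e n (k M) by move=> omega; apply => /=.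
  have mB := measurable_backtrack e n (k M).
  apply: le_trans (le_measure P _ _ FM) _; rewrite ?inE//.
  apply: le_trans (backtrack_le _ n0 e0) _; rewrite lee_fin.
  rewrite ler_pM2r ?invr_gt0 ?mulr_gt0 ?ltr0n//.
  by have [_] := kP M; lra.
- move=> omega xi nF cv; set r := nrm _ - n%:R * e.
  have [N _ NP] := cvg_shadow genS delta0 hyp r cv.
  have [j Nj nj] : exists2 j, (N <= j)%N & ~ backtrack e n (k j) omega.
    apply: contrapT => nex; apply: nF; exists N => // j /= Nj.
    by apply: contrapT => nb; apply: nex; exists j.
  have sh := NP (n + k j)%N (leq_trans Nj (leq_trans (kP j).1 (leq_addl _ _))).
  apply: (shadow_near genS hyp sh).
  move: nj; rewrite /backtrack /= /r => /negP; rewrite -leNgt; lra.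
Qed.

End Tracking.

(** * Mutual singularity of the harmonic measures *)

Section Counting.
Context {R : realType}.
Local Open Scope ereal_scope.

(** Each point of the ball has weight at least exp (- c r). *)
Lemma card_ball (T : choiceType) (N : T -> R) (c r : R) : (0 <= c)%R ->
  \esum_(x in [set x | (N x <= r)%R]) 1 <=
  (expR (c * r))%:E * \esum_(x in [set: T]) (expR (- (c * N x)))%:E.
Proof.
move=> c0; rewrite -esumZl ?lee_fin ?expR_ge0//.
rewrite [leLHS]esum_mkcond; apply: le_esum => x _; case: ifPn => [|_].
  rewrite inE /= => xr; rewrite -EFinM lee_fin -expRD -[leLHS]expR0 ler_expR.
  by rewrite subr_ge0 ler_wpM2l.
by rewrite -EFinM lee_fin mulr_ge0// expR_ge0.
Qed.

Lemma card_product_set (G : groupType) (A B X : set G) :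
  (forall x, X x -> exists2 a, A a & B (a^-1 * x)%g) ->
  \esum_(x in X) 1 <= (\esum_(x in A) 1) * (\esum_(x in B) 1) :> \bar R.
Proof.
move=> XAB.
have indE (C : set G) : \esum_(x in C) 1 = \esum_(x in [set: G]) @ind R _ C x.
  rewrite esum_mkcond; apply: eq_esum => x _; rewrite /ind indicE.
  by case: (x \in C).
have i0 (C : set G) x : 0 <= @ind R _ C x by exact: ind_ge0.
apply: (@le_trans _ _ (\esum_(x in [set: G]) \esum_(a in [set: G])
    (@ind R _ A a * ind B (a^-1 * x)%g))).
  rewrite indE; apply: le_esum => x _.
  case: (@indP R _ X x) => -[Xx ->]; last by apply: esum_ge0 => a _; rewrite mule_ge0.
  have [a Aa Bx] := XAB x Xx.
  apply: le_trans (@le_esum1 _ _ _ _ a _ _) => //; first by rewrite !ind1// mule1.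
  by move=> b; rewrite mule_ge0.
rewrite esum_exchange; last by move=> x y; rewrite mule_ge0.
rewrite [X in _ <= X * _]indE muleC -esumZl//; last by apply: esum_ge0.
apply: le_esum => a _; rewrite esumZl// muleC.
rewrite indE [leLHS]muleC [leRHS]muleC; apply: lee_wpmul2l => //.
rewrite (reindex_esum setT _ (fun y => a * y)%g); last first.
  split => //; first by move=> x y _ _; exact: mulgI.
  by move=> y _; exists (a^-1 * y)%g => //; rewrite mulVKg.
by apply: le_esum => y _; rewrite mulKg.
Qed.

End Counting.

Section GoodEvents.
Context {R : realType} d (Omega : measurableType d) (P : probability Omega R)
  (G : groupType) (cG : countable [set: G]) (p : G -> R) (pp : is_probability p)
  (X : nat -> Omega -> G) (lawX : forall n, has_law P (X n) p)
  (indX : independent P X).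
Context {H : groupType} (S : seq H) (genS : generating S) (phi : G -> H)
  (phiM : {morph phi : x y / (x * y)%g})
  (delta : R) (delta0 : 0 <= delta)
  (hyp : forall x y z : H, Num.min (gromov_product R S 1%g x z)
     (gromov_product R S 1%g z y) - delta <= gromov_product R S 1%g x y).
Context (a : nat -> R)
  (aE : forall n, mean (convolution_power p n)
     (fun x => (word_norm S (phi x))%:R%:E) = (a n)%:E).
Local Notation p_ := (convolution_power p).
Local Notation nrm x := ((word_norm S x)%:R : R).
Let l := growth_rate a.
Local Notation w n := (segment X 0 n).

Let f (n : nat) x := nrm (phi x).

Let f_ge0 n x : 0 <= f n x. Proof. by []. Qed.

Let f_sub n m x y : p_ n x != 0 -> p_ m y != 0 ->
  f (n + m)%N (x * y)%g <= f n x + f m y.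
Proof. by move=> _ _; rewrite /f phiM -natrD ler_nat word_normM. Qed.

Let f1_fin : (mean (p_ 1) (EFin \o f 1%N) < +oo)%E.
Proof. by rewrite /comp /f aE ltry. Qed.

Let aexp : a = expected p f.
Proof.
apply/funext => n; apply: EFin_inj.
by rewrite -(expectedE pp f_ge0 f_sub f1_fin) -aE.
Qed.

Let a0 n : 0 <= a n.
Proof. by rewrite aexp; exact: expected_ge0. Qed.

Lemma good_event e : 0 < e -> \forall n \near \oo, exists F : set Omega,
  [/\ measurable F, (P F <= (3 * e)%:E)%E &
    forall omega xi, ~ F omega ->
      in_group R S (phi (w m omega)) @[m --> \oo] --> in_boundary xi ->
      nrm (phi (w n omega)) <= n%:R * (l + e) /\
      shadow xi (n%:R * (l - 2 * e) - delta) (in_group R S (phi (w n omega)))].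
Proof.
move=> e0.
have [N1 _ conc] := subadditive_concentration pp f_ge0 f_sub f1_fin e0.
(* With precision [e ^+ 2] for the mean and 1 <= n e^2, the bound of [tracking] is at most 2 n e^2 /
   (2 n e) = e. The two tails of the norm cost [e] each, whence [3 * e]. *)
have e20 : 0 < e ^+ 2 by rewrite exprn_gt0.
have a_sub n m : a (n + m)%N <= a n + a m.
  by rewrite aexp; exact: expected_sub.
have [N2 _ fek] := growth_rate_near a0 a_sub e20.
near=> n.
have n1 : (N1 <= n)%N by near: n; exact: nbhs_infty_ge.
have n2 : (N2 <= n)%N by near: n; exact: nbhs_infty_ge.
have n0 : (0 < n)%N by near: n; exact: nbhs_infty_gt.
have ne : 1 / e ^+ 2 <= n%:R by near: n; exact: nbhs_infty_ger.
have [up low] := conc n n1; have {}fek := fek n n2.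
have [F [mF PF FP]] := tracking cG pp lawX indX genS phiM delta0 hyp a0 aE n0 e0.
rewrite -aexp -/l in up low.
set U := [set x | _] in up; set L := [set x | _] in low.
have mw A : measurable (w n @^-1` A) by exact: measurable_segment.
have PU : (P (w n @^-1` U) <= e%:E)%E by rewrite (segment_law cG pp lawX indX).
have PL : (P (w n @^-1` L) <= e%:E)%E by rewrite (segment_law cG pp lawX indX).
exists (F `|` (w n @^-1` U `|` w n @^-1` L)); split.
- by do 2?apply: measurableU.
- have -> : (3 * e)%:E = (e%:E + (e%:E + e%:E))%E by rewrite -!EFinD; congr _%:E; ring.
  apply: le_trans (measureU2 _ _ _) _ => //; first exact: measurableU.
  apply: leeD.
    apply: le_trans PF _; rewrite lee_fin ler_pdivrMr ?mulr_gt0 ?ltr0n//.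
    by move: ne fek; rewrite ler_pdivrMr// -/l; lra.
  apply: le_trans (measureU2 _ _ _) _ => //.
  by apply: leeD.
- move=> omega xi nF cv; split.
    by rewrite leNgt; apply/negP => h; apply: nF; right; left.
  apply: le_shadow (FP omega xi _ cv); last by move=> h; apply: nF; left.
  rewrite lerD2r.
  have : n%:R * (l - e) <= nrm (phi (w n omega)).
    by rewrite leNgt; apply/negP => h; apply: nF; right; right.
  lra.
Unshelve. all: by end_near. Qed.

End GoodEvents.

Section BorelSets.
Context {T : topologicalType}.
Implicit Types A : set T.

Lemma Borel_open A : open A -> Borel A.
Proof. exact: (@sub_sigma_algebra _ setT (@open T)). Qed.

Lemma Borel_setC A : Borel A -> Borel (~` A).
Proof.
by rewrite -setTD => BA; have [_ h _] := smallest_sigma_algebra [set: T] (@open T); exact: h.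
Qed.

Lemma Borel_bigcup (A : nat -> set T) : (forall n, Borel (A n)) -> Borel (\bigcup_n A n).
Proof.
by move=> BA; have [_ _ h] := smallest_sigma_algebra [set: T] (@open T); exact: h.
Qed.

Lemma Borel_lim_sup (A : nat -> set T) : (forall n, Borel (A n)) -> Borel (lim_sup_set A).
Proof.
move=> BA; rewrite -[lim_sup_set A]setCK /lim_sup_set setC_bigcap.
apply: Borel_setC; apply: Borel_bigcup => n; apply: Borel_setC.
rewrite bigcup_mkcond; apply: Borel_bigcup => k; case: ifP => // _.
by have [] := smallest_sigma_algebra [set: T] (@open T).
Qed.

End BorelSets.

Section Singularity.
Context {R : realType} {G : groupType} (S : seq G) (genS : generating S)
  (delta : R) (delta0 : 0 <= delta)
  (hyp : forall x y z : G, Num.min (gromov_product R S 1%g x z)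
     (gromov_product R S 1%g z y) - delta <= gromov_product R S 1%g x y)
  (mu : G -> R) (mup : is_probability mu) (mom : finite_first_moment mu).
Local Notation nrm x := ((word_norm S x)%:R : R).

Definition drift : R := growth_rate (expected mu (fun _ x => nrm x)).

Let length_mean n : mean (convolution_power mu n) (fun x => (nrm x)%:E) =
  (expected mu (fun _ x => nrm x) n)%:E.
Proof.
apply: (@expectedE _ _ _ mup (fun _ x => nrm x)) => //.
- by move=> k m x y _ _; rewrite -natrD ler_nat word_normM.
- by rewrite convolution_power1E//; exact: moment_word_norm.
Qed.

Let noise_length (phi : G * G -> G) rho n : 0 <= rho <= 1 ->
  {morph phi : x y / (x * y)%g} -> phi 1%g = 1%g ->
  (forall F, (forall x, (0 <= F x)%E) ->
    mean (noise rho mu) (F \o phi) = mean mu F) ->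
  mean (convolution_power (noise rho mu) n) (fun x => (nrm (phi x))%:E) =
  (expected mu (fun _ x => nrm x) n)%:E.
Proof.
move=> rho01 phiM phi1 phimu; have np := noise_prob mup rho01.
rewrite -length_mean -(mean_power_morph np mup phiM phi1 phimu n)//.
Qed.

Definition good_position (l e : R) (n : nat) (g : G * G)
    (z : boundary R S * boundary R S) : Prop :=
  [/\ nrm g.1 <= n%:R * (l + e), nrm g.2 <= n%:R * (l + e),
    shadow z.1 (n%:R * (l - 2 * e) - delta) (in_group R S g.1) &
    shadow z.2 (n%:R * (l - 2 * e) - delta) (in_group R S g.2)].

(** [v] is the position at time [n]; [F] joins the null event without convergence to the exceptional
    events of the two coordinates, of mass at most [3 * e] each. One space and one limit map serve
    all [e] and [n]. *)
Lemma harmonic_measure_positions rho nu : 0 <= rho <= 1 ->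
  harmonic_measure (noise rho mu) nu ->
  exists d (Omega : measurableType d) (P : probability Omega R)
    (winf : Omega -> boundary R S * boundary R S),
   [/\ forall A, Borel A -> measurable (winf @^-1` A),
      forall A, Borel A -> nu A = P (winf @^-1` A) &
      forall e, 0 < e -> \forall n \near \oo,
        exists (F : set Omega) (v : Omega -> G * G),
        [/\ measurable F, (P F <= (6 * e)%:E)%E,
         forall A, measurable (v @^-1` A) /\
           P (v @^-1` A) = mean (convolution_power (noise rho mu) n) (ind A) &
         forall omega, ~ F omega -> good_position drift e n (v omega) (winf omega)]].
Proof.
move=> rho01 [d [T [P [w [winf [[X [lawX indX wX]] [N [mN N0 cvN]] mwinf nuE]]]]]].
exists d, T, P, winf; split=> // e e0.
have np := noise_prob mup rho01.
have cG : countable [set: G * G].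
  by rewrite -setXTT; apply: countableX; exact: generating_countable genS.
have wE n omega : w n omega = segment X 0 n omega by rewrite wX.
have fstE n : mean (convolution_power (noise rho mu) n) (fun x => (nrm x.1)%:E) =
    (expected mu (fun _ x => nrm x) n)%:E.
  by apply: (noise_length (phi := fst)) => // F F0; exact: mean_noise_fst.
have sndE n : mean (convolution_power (noise rho mu) n) (fun x => (nrm x.2)%:E) =
    (expected mu (fun _ x => nrm x) n)%:E.
  by apply: (noise_length (phi := snd)) => // F F0; exact: mean_noise_snd.
have [N1 _ good1] := good_event cG np lawX indX genS (phi := fst)
  (fun _ _ => erefl) delta0 hyp fstE e0.
have [N2 _ good2] := good_event cG np lawX indX genS (phi := snd)
  (fun _ _ => erefl) delta0 hyp sndE e0.
near=> n.
have n1 : (N1 <= n)%N by near: n; exact: nbhs_infty_ge.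
have n2 : (N2 <= n)%N by near: n; exact: nbhs_infty_ge.
have [F1 [mF1 PF1 gF1]] := good1 n n1.
have [F2 [mF2 PF2 gF2]] := good2 n n2.
exists (N `|` (F1 `|` F2)), (segment X 0 n); split.
- by do 2?apply: measurableU.
- have -> : (6 * e)%:E = (0 + ((3 * e)%:E + (3 * e)%:E))%E.
    by rewrite add0e -EFinD; congr _%:E; ring.
  apply: le_trans (measureU2 _ _ _) _ => //; first exact: measurableU.
  apply: leeD; first by rewrite le_eqVlt (introT eqP N0).
  by apply: le_trans (measureU2 _ _ _) _ => //; exact: leeD.
- move=> A; split; first exact: measurable_segment.
  exact: segment_law.
- move=> omega nF.
  have [cv1 cv2] : (in_group R S (w n omega).1 @[n --> \oo] -->
      in_boundary (winf omega).1) /\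
      (in_group R S (w n omega).2 @[n --> \oo] --> in_boundary (winf omega).2).
    by apply: contrapT => ncv; apply: nF; left; exact: cvN.
  have nF1 : ~ F1 omega by move=> h; apply: nF; right; left.
  have nF2 : ~ F2 omega by move=> h; apply: nF; right; right.
  have {}cv1 : in_group R S (segment X 0 m omega).1 @[m --> \oo] -->
      in_boundary (winf omega).1.
    by under eq_fun do rewrite -wE.
  have {}cv2 : in_group R S (segment X 0 m omega).2 @[m --> \oo] -->
      in_boundary (winf omega).2.
    by under eq_fun do rewrite -wE.
  have [a1 b1] := gF1 _ _ nF1 cv1; have [a2 b2] := gF2 _ _ nF2 cv2.
  by split.
Unshelve. all: by end_near. Qed.

(* Dual shadows make this set open, hence Borel. *)
Definition limit_set (A : set (G * G)) (r : R) : set (boundary R S * boundary R S) :=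
  [set z | exists2 a, A a & @dual_shadow R G S a.1 r z.1 /\ @dual_shadow R G S a.2 r z.2].

Lemma limit_set_open A r : open (limit_set A r).
Proof.
have -> : limit_set A r = \bigcup_(a in A)
    (@dual_shadow R G S a.1 r `*` @dual_shadow R G S a.2 r).
  by apply/seteqP; split => z [a Aa zA]; exists a.
apply: bigcup_open => a _.
rewrite openE => -[z1 z2] [/= h1 h2].
exists (@dual_shadow R G S a.1 r, @dual_shadow R G S a.2 r) => //=.
by split; apply: open_nbhs_nbhs; split=> //; exact: (dual_shadow_open genS delta0 hyp).
Qed.

Definition positions (p : G * G -> R) (n : nat) (e : R) : set (G * G) :=
  [set a | [/\ heavy_set p n (n%:R * (entropy_rate p + e)) a,
    nrm a.1 <= n%:R * (drift + e) & nrm a.2 <= n%:R * (drift + e)]].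

Definition typical_limits (p : G * G -> R) (n : nat) (e : R) :=
  limit_set (positions p n e) (n%:R * (drift - 2 * e) - delta).

Section one_walk.
Context (rho : R) (rho01 : 0 <= rho <= 1) (nu : set (boundary R S * boundary R S) -> \bar R).
Context (nuH : harmonic_measure (noise rho mu) nu).

(** Off the exceptional event of mass [6 * e], the limit is missed only if the position is not
    heavy, which costs one more [e]. *)
Lemma typical_limits_full e : 0 < e -> \forall n \near \oo,
  (nu (~` typical_limits (noise rho mu) n e) <= (7 * e)%:E)%E.
Proof.
move=> e0; have np := noise_prob mup rho01.
have efin := noise_finite_entropy genS mup rho01 mom.
have [d [T [P [winf [mwinf nuE good]]]]] := harmonic_measure_positions rho01 nuH.
have [N1 _ conc] := entropy_concentration np efin e0.
have [N2 _ {}good] := good e e0.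
near=> n.
have n1 : (N1 <= n)%N by near: n; exact: nbhs_infty_ge.
have n2 : (N2 <= n)%N by near: n; exact: nbhs_infty_ge.
have [up _] := conc n n1.
have [F [v [mF PF lawv gF]]] := good n n2.
set E := typical_limits _ _ _.
have BE : Borel (~` E) by apply: Borel_setC; apply: Borel_open; exact: limit_set_open.
rewrite nuE//.
set A := heavy_set (noise rho mu) n (n%:R * (entropy_rate (noise rho mu) + e)).
have [mA PA] := lawv (~` A).
have {}PA : (P (v @^-1` (~` A)) <= e%:E)%E.
  by rewrite PA; apply: le_trans up; exact: mean_heavy_set.
have sub : winf @^-1` (~` E) `<=` F `|` v @^-1` (~` A).
  move=> omega nE; apply: contrapT => /not_orP[nF nA].
  have [a1 a2 s1 s2] := gF omega nF.
  apply: nE; exists (v omega); first by split => //; exact: contrapT.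
  by split; exact: sub_dual_shadow.
apply: le_trans (le_measure P _ _ sub) _; rewrite ?inE.
- exact: mwinf.
- exact: measurableU.
have -> : (7 * e)%:E = ((6 * e)%:E + e%:E)%E by rewrite -EFinD; congr _%:E; ring.
apply: le_trans (measureU2 _ _ _) _ => //; exact: leeD.
Unshelve. all: by end_near. Qed.

(* If the limit lies in the typical set of a walk of smaller entropy, then
   w_n is within 6 n e + O(1) of one of exp (n (h + e)) elements, while its
   law gives each point at most exp (- n (h' - e)). *)
Lemma typical_limits_null (rho' : R) : 0 <= rho' <= 1 ->
  entropy_rate (noise rho' mu) < entropy_rate (noise rho mu) ->
  exists2 e0 : R, 0 < e0 & forall e, 0 < e <= e0 -> \forall n \near \oo,
  (nu (typical_limits (noise rho' mu) n e) <= (8 * e)%:E)%E.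
Proof.
move=> rho'01; set h := entropy_rate _; set h' := entropy_rate _ => hh'.
have np := noise_prob mup rho01; have np' := noise_prob mup rho'01.
have efin := noise_finite_entropy genS mup rho01 mom.
have [d [T [P [winf [mwinf nuE good]]]]] := harmonic_measure_positions rho01 nuH.
have [c c0 sc] := growth_summable (R := R) genS.
have := pair_growth_summable sc.
set K := (\esum_(z in _) _)%E => Kfin.
have K0 : (0 <= K)%E by apply: esum_ge0 => z _; rewrite lee_fin expR_ge0.
have KE : K = (fine K)%:E by rewrite fineK// ge0_fin_numE.
pose k := fine K; have k0 : 0 <= k by exact: fine_ge0.
have dh : 0 < h' - h by rewrite subr_gt0.
(* Twice 2 + 12 c, the total loss in the exponent per unit of [e]: 2 from the two entropy estimates,
   12 c from the balls of radius [r]. Half of the entropy gap survives. *)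
pose D := 4 * (1 + 6 * c).
have D0 : 0 < D by rewrite /D; lra.
exists ((h' - h) / D); first by rewrite divr_gt0.
move=> e /andP[e0 eD].
have eD' : (2 + 12 * c) * e <= (h' - h) / 2.
  by move: eD; rewrite ler_pdivlMr// /D; lra.
have [N1 _ conc] := entropy_concentration np efin e0.
have [N2 _ {}good] := good e e0.
(* The part of the cardinal bound for the balls that does not depend on [n]. *)
pose C := k * expR (c * (20 * delta)).
have C0 : 0 <= C by rewrite mulr_ge0// expR_ge0.
have C1 : 0 < C + 1 by rewrite ltr_wpDl.
have [N3 _ small] := @near_expRN R ((h' - h) / 2) (e / (C + 1))
  (divr_gt0 dh (ltr0n _ 2)) (divr_gt0 e0 C1).
near=> n.
have n1 : (N1 <= n)%N by near: n; exact: nbhs_infty_ge.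
have n2 : (N2 <= n)%N by near: n; exact: nbhs_infty_ge.
have n3 : (N3 <= n)%N by near: n; exact: nbhs_infty_ge.
have [_ low] := conc n n1; have {}small := small n n3.
have [F [v [mF PF lawv gF]]] := good n n2.
set E := typical_limits _ _ _.
have BE : Borel E by apply: Borel_open; exact: limit_set_open.
rewrite nuE//.
pose A := heavy_set (noise rho' mu) n (n%:R * (h + e)).
pose r := 12 * (n%:R * e) + 20 * delta.
pose Close := [set x : G * G | exists2 a, A a & pair_norm S (a^-1 * x)%g <= r].
have [mA PA] := lawv Close.
have {}PA : (P (v @^-1` Close) <= (e%:E + e%:E))%E.
  rewrite PA; apply: le_trans (mean_low_weight np n (n%:R * (h' - e)) Close) _.
  apply: leeD => //.
  have cardClose : (\esum_(x in Close) 1 <=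
      (expR (n%:R * (h + e)))%:E * ((expR (c * r))%:E * k%:E))%E.
    apply: le_trans (@card_product_set R _ A [set x | pair_norm S x <= r] Close _) _.
      by move=> x [a Aa xa]; exists a.
    apply: lee_pmul.
    - by apply: esum_ge0.
    - by apply: esum_ge0.
    - exact: card_heavy_set.
    - by rewrite -KE; apply: card_ball; exact: ltW.
  apply: le_trans (lee_wpmul2l _ cardClose) _; first by rewrite lee_fin expR_ge0.
  rewrite -!EFinM lee_fin.
  have -> : expR (- (n%:R * (h' - e))) * (expR (n%:R * (h + e)) * (expR (c * r) * k)) =
      expR (- (n%:R * (h' - h - (2 + 12 * c) * e))) * C.
    rewrite mulrA -expRD mulrA -expRD mulrC /C mulrCA -expRD.
    by congr (_ * expR _); rewrite /r; ring.
  apply: (@le_trans _ _ (e / (C + 1) * C)).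
    rewrite ler_wpM2r//; apply: le_trans small; rewrite ler_expR lerN2.
    by rewrite ler_wpM2l//; lra.
  by rewrite mulrAC ler_pdivrMr// ler_wpM2l ?lerDl// ltW.
have sub : winf @^-1` E `<=` F `|` v @^-1` Close.
  move=> omega [a [Aa al1 al2] [/(dual_shadow_sub genS delta0 hyp) d1 /(dual_shadow_sub genS delta0 hyp) d2]].
  have [Fo|nF] := pselect (F omega); [by left|right].
  have [vl1 vl2 s1 s2] := gF omega nF.
  exists a => //; rewrite /pair_norm /=.
  (* The distance is |x| + |y| - 2 (x | y), and 2 (l + e) - 2 (l - 2 e) = 6 e. The product (x | y)
     loses 5 delta: one from [good_position], two from the dual shadow, two from
     [shadow_gromov_product]. Both coordinates together give [r]. *)
  have dist x y xi : nrm x <= n%:R * (drift + e) -> nrm y <= n%:R * (drift + e) ->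
     shadow xi (n%:R * (drift - 2 * e) - delta - 2 * delta) (in_group R S x) ->
     shadow xi (n%:R * (drift - 2 * e) - delta) (in_group R S y) ->
     nrm (x^-1 * y)%g <= 6 * (n%:R * e) + 10 * delta.
    move=> xl yl xs ys.
    have ys' : shadow xi (n%:R * (drift - 2 * e) - delta - 2 * delta) (in_group R S y).
      by apply: le_shadow ys; rewrite gerBl mulr_ge0.
    have := shadow_gromov_product genS delta0 hyp xs ys'.
    rewrite (gromov_productE genS); lra.
  have := dist _ _ _ al1 vl1 d1 s1; have := dist _ _ _ al2 vl2 d2 s2.
  by rewrite /r; lra.
apply: le_trans (le_measure P _ _ sub) _; rewrite ?inE.
- exact: mwinf.
- exact: measurableU.
have -> : (8 * e)%:E = ((6 * e)%:E + (e%:E + e%:E))%E.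
  by rewrite -!EFinD; congr _%:E; ring.
apply: le_trans (measureU2 _ _ _) _ => //; exact: leeD.
Unshelve. all: by end_near. Qed.

End one_walk.

Lemma singular_of_lt (rho rho' : R)
    (nu nu' : set (boundary R S * boundary R S) -> \bar R) : 0 <= rho <= 1 -> 0 <= rho' <= 1 ->
  harmonic_measure (noise rho mu) nu -> harmonic_measure (noise rho' mu) nu' ->
  entropy_rate (noise rho mu) < entropy_rate (noise rho' mu) ->
  mutually_singular nu nu'.
Proof.
move=> rho01 rho'01 nuH nuH' hh'.
have [e0 e00 null] := typical_limits_null rho'01 nuH' rho01 hh'.
(* Makes the errors [7 * e k] and [8 * e k] at most 2^-(k+1), hence summable. *)
pose e k : R := Num.min e0 ((1 / 8) / (2 ^ k.+1)%:R).
have e_gt0 k : 0 < e k by rewrite lt_min e00 divr_gt0// ltr0n expn_gt0.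
have e_le k : e k <= (1 / 8) / (2 ^ k.+1)%:R by rewrite ge_min lexx orbT.
have /choice[n nP] : forall k, exists n,
   (nu (~` typical_limits (noise rho mu) n (e k)) <= (1 / (2 ^ k.+1)%:R)%:E)%E /\
   (nu' (typical_limits (noise rho mu) n (e k)) <= (1 / (2 ^ k.+1)%:R)%:E)%E.
  move=> k; have le8 c : 0 <= c <= 8 -> ((c * e k)%:E <= (1 / (2 ^ k.+1)%:R)%:E)%E.
    move=> /andP[? ?]; rewrite lee_fin (@le_trans _ _ (8 * e k))//.
      by rewrite ler_wpM2r// ltW.
    by have := e_le k; lra.
  have [N1 _ full] := typical_limits_full rho01 nuH (e_gt0 k).
  have [|N2 _ {}null] := null (e k); first by rewrite e_gt0 /= ge_min lexx.
  exists (N1 + N2)%N; split.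
    by apply: le_trans (full _ (leq_addr _ _)) _; apply: le8; lra.
  by apply: le_trans (null _ (leq_addl _ _)) _; apply: le8; lra.
pose E k := typical_limits (noise rho mu) (n k) (e k).
have BE k : Borel (E k) by apply: Borel_open; exact: limit_set_open.
have BC k : Borel (~` E k) by exact: Borel_setC.
have [d [T [P [winf [mwinf nuE _]]]]] := harmonic_measure_positions rho01 nuH.
have [d' [T' [P' [winf' [mwinf' nuE' _]]]]] := harmonic_measure_positions rho'01 nuH'.
(* Borel-Cantelli is applied on the sample space, where [Q] is a genuine measure, and preimages
   commute with upper limits. *)
have cantelli d0 (U : measurableType d0) (Q : probability U R)
    (f : U -> boundary R S * boundary R S) (B : nat -> set _) :
    (forall k, measurable (f @^-1` B k)) ->
    (forall k, (Q (f @^-1` B k) <= (1 / (2 ^ k.+1)%:R)%:E)%E) ->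
    Q (f @^-1` lim_sup_set B) = 0%E.
  move=> mB QB; rewrite (_ : _ @^-1` _ = lim_sup_set (fun k => f @^-1` B k)).
    apply: lim_sup_set_cvg0 => //.
    apply: (@le_lt_trans _ _ (1%:E)); last exact: ltry.
    apply: le_trans (@epsilon_trick0 R 1 xpredT ler01).
    by apply: lee_nneseries => [k _ _|k _]; [exact: measure_ge0|exact: QB].
  by apply/seteqP; split => x xB m _; have [j mj Bj] := xB m I; exists j.
have BL : Borel (lim_sup_set (fun k => ~` E k)) by exact: Borel_lim_sup.
(* Its complement is the lower limit of the [E k], contained in their upper limit, which is null for
   [nu']. *)
exists (lim_sup_set (fun k => ~` E k)); split => //.
- rewrite nuE//; apply: cantelli => k; first exact: mwinf.
  by rewrite -nuE//; have [] := nP k.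
- rewrite nuE'; last exact: Borel_setC.
  have BLE : Borel (lim_sup_set E) by exact: Borel_lim_sup.
  have zero : P' (winf' @^-1` lim_sup_set E) = 0%E.
    apply: cantelli => k; first exact: mwinf'.
    by rewrite -nuE'//; have [] := nP k.
  apply/eqP; rewrite eq_le measure_ge0 andbT -[leRHS]zero.
  apply: le_measure; rewrite ?inE; [by apply: mwinf'; exact: Borel_setC|exact: mwinf'|].
  apply: preimage_subset => z nz m _.
  apply: contrapT => nE; apply: nz => m' _; exists (maxn m m') => /=; first exact: leq_maxr.
  by move=> Ez; apply: nE; exists (maxn m m') => //=; exact: leq_maxl.
Qed.

End Singularity.

Lemma mutually_singular_sym (R : realType) (T : topologicalType)
    (nu nu' : set T -> \bar R) : mutually_singular nu nu' -> mutually_singular nu' nu.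
Proof. by move=> [A [BA ? ?]]; exists (~` A); rewrite setCK; split => //; exact: Borel_setC. Qed.

Theorem mainTheorem4 (R : realType) (Gamma : groupType) (S : seq Gamma)
    (mu : Gamma -> R) (rho rho' : R)
    (hyp_Gamma : hyperbolic_generating R S)
    (prob_mu : is_probability mu)
    (nonelem_mu : nonelementary mu)
    (moment_mu : finite_first_moment mu)
    (rho_01 : 0 <= rho <= 1) (rho'_01 : 0 <= rho' <= 1)
    (neq_h : asymptotic_entropy (noise rho mu) <>
             asymptotic_entropy (noise rho' mu)) :
  (tv_distance (convolution_power (noise rho mu) n)
                   (convolution_power (noise rho' mu) n) @[n --> \oo]
     --> (1 : R)) /\
  (forall nu nu' : set (boundary R S * boundary R S) -> \bar R,
     harmonic_measure (noise rho mu) nu ->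
     harmonic_measure (noise rho' mu) nu' ->
     mutually_singular nu nu').
Proof.
have [genS [delta hyp]] := hyp_Gamma.
(* Hyperbolicity does not prescribe the sign of its constant; enlarging it preserves the
   inequality. *)
pose delta' := Num.max delta 0.
have delta'0 : 0 <= delta' by rewrite le_max lexx orbT.
have hyp' (x y z : Gamma) : Num.min (gromov_product R S 1%g x z)
    (gromov_product R S 1%g z y) - delta' <= gromov_product R S 1%g x y.
  apply: le_trans (hyp x y z 1%g).
  by rewrite lerD2l lerN2 le_max lexx.
have np := noise_prob prob_mu rho_01; have np' := noise_prob prob_mu rho'_01.
have fin := noise_finite_entropy genS prob_mu rho_01 moment_mu.
have fin' := noise_finite_entropy genS prob_mu rho'_01 moment_mu.
move: neq_h; rewrite !asymptotic_entropyE//.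
case: (ltgtP (entropy_rate (noise rho mu)) (entropy_rate (noise rho' mu))) => [h|h|->//] _.
- split; first exact: tv_distance_cvg1.
  move=> nu nu' H H'.
  exact: (singular_of_lt genS delta'0 hyp' prob_mu moment_mu rho_01 rho'_01 H H' h).
- split.
    under eq_cvg do rewrite tv_distanceC; exact: tv_distance_cvg1.
  move=> nu nu' H H'; apply: mutually_singular_sym.
  exact: (singular_of_lt genS delta'0 hyp' prob_mu moment_mu rho'_01 rho_01 H' H h).
Qed.
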